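(* Let $V$ be a (Hausdorff) nuclear space. Then the topology on $\mathcal{S}^\bullet(V)$, i.e. the one defined by the seminorms $\|\cdot\|_\alpha^\bullet$ for all $\|\cdot\|_\alpha\in\mathcal{P}_V$, coincides with the locally convex topology on the symmetric tensors defined by the seminorms $\|\cdot\|_{\alpha,\mathrm{pr}}^\bullet$ for all $\|\cdot\|_\alpha\in\mathcal{P}_V$.
   Context: $V$ is complex. Let $\mathcal{I}_V$ be the set of continuous positive Hermitian forms $\langle\cdot\,|\,\cdot\rangle_\alpha$ on $V$ (sesquilinear, antilinear in the first argument, Hermitian, positive semi-definite), $\|v\|_\alpha:=\sqrt{\langle v|v\rangle_\alpha}$, and $\mathcal{P}_V$ the set of all these seminorms (for a nuclear space $\mathcal{P}_V$ is cofinal in the set of all continuous seminorms). Let $\mathcal{T}^k_{\mathrm{alg}}(V)$ be the algebraic $k$-th tensor power ($\mathcal{T}^0_{\mathrm{alg}}(V)=\mathbb{C}$), $\mathcal{T}^\bullet_{\mathrm{alg}}(V)=\bigoplus_{k\ge 0}\mathcal{T}^k_{\mathrm{alg}}(V)$, and $\langle X\rangle_k$ the degree-$k$ component of $X$. Each $\langle\cdot|\cdot\rangle_\alpha\in\mathcal{I}_V$ is extended to a positive Hermitian form $\langle X|Y\rangle_\alpha^\bullet:=\sum_{k}\langle\langle X\rangle_k|\langle Y\rangle_k\rangle_\alpha^\bullet$ on $\mathcal{T}^\bullet_{\mathrm{alg}}(V)$, where $\langle x_1\otimes\cdots\otimes x_k|y_1\otimes\cdots\otimes y_k\rangle_\alpha^\bullet:=k!\prod_{m=1}^k\langle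 x_m|y_m\rangle_\alpha$; set $\|X\|_\alpha^\bullet:=\sqrt{\langle X|X\rangle_\alpha^\bullet}$. $\mathcal{S}^\bullet(V)\subseteq\mathcal{T}^\bullet_{\mathrm{alg}}(V)$ is the subspace of symmetric tensors. For $\|\cdot\|_\alpha\in\mathcal{P}_V$ and $X\in\mathcal{T}^\bullet_{\mathrm{alg}}(V)$, $$\|X\|_{\alpha,\mathrm{pr}}^\bullet:=|\langle X\rangle_0|+\sum_{k=1}^\infty\sqrt{k!}\,\inf\sum_{i\in I}\prod_{m=1}^k\|x_{i,m}\|_\alpha,$$ where the infimum runs over all ways to write $\langle X\rangle_k=\sum_{i\in I}x_{i,1}\otimes\cdots\otimes x_{i,k}$ as a finite sum of factorizing tensors. *)

(* Defs.v *)
From HB Require Import structures.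
From mathcomp Require Import all_boot all_order all_algebra.
From mathcomp Require Import perm ring_quotient complex freeg ring.
From mathcomp Require Import all_classical all_reals all_analysis.

Set Implicit Arguments.
Unset Strict Implicit.
Unset Printing Implicit Defensive.
Import Order.TTheory GRing.Theory Num.Theory numFieldNormedType.Exports.
Local Open Scope quotient_scope.
Local Open Scope classical_set_scope.
Local Open Scope ring_scope.

Section Multilinear.
Variables (K : comNzRingType) (V : lmodType K) (k : nat).

Definition fupd (x : {ffun 'I_k -> V}) (i : 'I_k) (v : V) : {ffun 'I_k -> V} :=
  [ffun j => if j == i then v else x j].

Definition multilinear (W : lmodType K) (f : {ffun 'I_k -> V} -> W) :=
  forall (x : {ffun 'I_k -> V}) (i : 'I_k), linear (fun v => f (fupd x i v)).

(* The tensor power is the free module on V^k modulo the span of the elements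
   [fupd x i (a u + v)] - a [fupd x i u] - [fupd x i v]. *)
Definition tensor_relator (t : {ffun 'I_k -> V} * 'I_k * K * V * V) :
    {freeg {ffun 'I_k -> V} / K} :=
  let: (x, i, a, u, v) := t in
  << fupd x i (a *: u + v) >> - a *: << fupd x i u >> - << fupd x i v >>.

Definition tensor_relations : {pred {freeg {ffun 'I_k -> V} / K}} :=
  [pred D | `[< exists s : seq (K * ({ffun 'I_k -> V} * 'I_k * K * V * V)),
                 D = \sum_(r <- s) r.1 *: tensor_relator r.2 >] ].

Lemma tensor_relationsP D :
  reflect (exists s : seq (K * ({ffun 'I_k -> V} * 'I_k * K * V * V)),
             D = \sum_(r <- s) r.1 *: tensor_relator r.2)
          (D \in tensor_relations).
Proof. exact: asboolP. Qed.

Lemma tensor_relationsZ a D :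
  D \in tensor_relations -> a *: D \in tensor_relations.
Proof.
move=> /tensor_relationsP[s ->]; apply/tensor_relationsP.
exists [seq (a * r.1, r.2) | r <- s]; rewrite big_map scaler_sumr.
by apply: eq_bigr => r _; rewrite scalerA.
Qed.

Lemma tensor_relations_zmod : zmod_closed tensor_relations.
Proof.
split=> [|D E HD HE]; first by apply/tensor_relationsP; exists [::]; rewrite big_nil.
rewrite -scaleN1r; have := tensor_relationsZ (-1) HE.
move: HD => /tensor_relationsP[s ->] /tensor_relationsP[t ->].
by apply/tensor_relationsP; exists (s ++ t); rewrite big_cat.
Qed.

HB.instance Definition _ :=
  GRing.isZmodClosed.Build _ tensor_relations tensor_relations_zmod.

Definition tpow : Type := Quotient.quot tensor_relations.
HB.instance Definition _ := GRing.Zmodule.on tpow.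
HB.instance Definition _ := EqQuotient.on tpow.

Lemma tpow_eqP (D E : {freeg {ffun 'I_k -> V} / K}) :
  \pi_tpow D = \pi_tpow E <-> D - E \in tensor_relations.
Proof.
by rewrite [_ \in _](Quotient.idealrBE tensor_relations D E); split=> [->|/eqP].
Qed.

Lemma tpow_piD (D E : {freeg {ffun 'I_k -> V} / K}) :
  \pi_tpow (D + E) = \pi_tpow D + \pi_tpow E.
Proof. exact: Quotient.pi_add. Qed.

Lemma tpow_pi0 : \pi_tpow (0 : {freeg {ffun 'I_k -> V} / K}) = 0.
Proof. by apply: (addIr (\pi_tpow 0)); rewrite -tpow_piD !add0r. Qed.

Definition tpow_scale (a : K) (X : tpow) : tpow := \pi_tpow (a *: repr X).

Lemma tpow_piZ a (D : {freeg {ffun 'I_k -> V} / K}) :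
  \pi_tpow (a *: D) = tpow_scale a (\pi_tpow D).
Proof.
apply: (iffRL (tpow_eqP _ _)); rewrite -scalerBr; apply: tensor_relationsZ.
by apply: (iffLR (tpow_eqP _ _)); rewrite reprK.
Qed.

Lemma tpow_scaleA a b X : tpow_scale a (tpow_scale b X) = tpow_scale (a * b) X.
Proof. by rewrite -[X]reprK -(tpow_piZ b) -(tpow_piZ a) -(tpow_piZ (a * b)) scalerA. Qed.
Lemma tpow_scale1 X : tpow_scale 1 X = X.
Proof. by rewrite -[X]reprK -(tpow_piZ 1) scale1r. Qed.
Lemma tpow_scaleDr a X Y : tpow_scale a (X + Y) = tpow_scale a X + tpow_scale a Y.
Proof. by rewrite -[X]reprK -[Y]reprK -tpow_piD -!(tpow_piZ a) scalerDr tpow_piD. Qed.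
Lemma tpow_scaleDl X a b : tpow_scale (a + b) X = tpow_scale a X + tpow_scale b X.
Proof.
rewrite -[X]reprK -(tpow_piZ a) -(tpow_piZ b) -(tpow_piZ (a + b)).
by rewrite scalerDl tpow_piD.
Qed.

HB.instance Definition _ := GRing.Zmodule_isLmodule.Build K tpow
  tpow_scaleA tpow_scale1 tpow_scaleDr tpow_scaleDl.

Definition tens (x : {ffun 'I_k -> V}) : tpow := \pi_tpow << x >>.

(* Meaningful when f is multilinear: tlift f is then the unique linear map with
   tlift f (tens x) = f x (tlift_linear, tlift_tens, tlift_unique). *)
Definition tlift (W : lmodType K) (f : {ffun 'I_k -> V} -> W) (X : tpow) : W :=
  fglift f (repr X).

Lemma tpow_pi_linear : linear (\pi_tpow : {freeg {ffun 'I_k -> V} / K} -> tpow).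
Proof. by move=> a D E; rewrite tpow_piD tpow_piZ. Qed.

Lemma tens_multilinear : multilinear tens.
Proof.
move=> x i a u v; rewrite -tpow_pi_linear; apply: (iffRL (tpow_eqP _ _)).
rewrite opprD addrA; apply/tensor_relationsP.
by exists [:: (1, (x, i, a, u, v))]; rewrite big_seq1 scale1r.
Qed.

Lemma tens_span (X : tpow) :
  exists s : seq (K * {ffun 'I_k -> V}), X = \sum_(r <- s) r.1 *: tens r.2.
Proof.
exists [seq (coeff x (repr X), x) | x <- dom (repr X)].
rewrite big_map -[LHS]reprK -[in LHS](freeg_sumE (repr X)).
elim: (dom _) => [|x s IH]; first by rewrite !big_nil tpow_pi0.
rewrite !big_cons tpow_piD IH; congr (_ + _).
rewrite -[RHS]tpow_piZ; congr (\pi_tpow _).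
by apply/eqP/freeg_eqP => y; rewrite coeffZ !coeffU mul1r.
Qed.

Section Lift.
Variables (W : lmodType K) (f : {ffun 'I_k -> V} -> W).

Lemma fglift_linear : linear (fglift f).
Proof.
move=> a D E; have fB := lift_is_additive f.
have f0 : fglift f 0 = 0 by rewrite -(subrr 0) fB subrr.
have fD F G : fglift f (F + G) = fglift f F + fglift f G.
  by rewrite -[G in LHS]opprK fB -[- G]sub0r fB f0 sub0r opprK.
rewrite fD; congr (_ + _).
rewrite -(freeg_sumE D) scaler_sumr; elim: (dom D) => [|x s IH].
  by rewrite !big_nil f0 scaler0.
rewrite !big_cons !fD IH scalerDr; congr (_ + _).
rewrite (_ : a *: _ = << a * coeff x D *g x >>) ?liftU ?scalerA//.
by apply/eqP/freeg_eqP => y; rewrite coeffZ !coeffU mulrA.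
Qed.

Hypothesis fM : multilinear f.

Lemma tlift_pi D : tlift f (\pi_tpow D) = fglift f D.
Proof.
have fB := lift_is_additive f; have fL := fglift_linear.
have f0 : fglift f 0 = 0 by rewrite -(subrr 0) fB subrr.
have /tpow_eqP/tensor_relationsP[s Ds] : \pi_tpow (repr (\pi_tpow D)) = \pi_tpow D.
  by rewrite reprK.
apply/eqP; rewrite -subr_eq0 /tlift -fB Ds; apply/eqP.
elim: s {Ds} => [|[c [[[[x i] a] u] v]] s IH]; first by rewrite big_nil f0.
rewrite big_cons fL IH addr0 /= !fB -[a *: << _ >>]addr0 fL f0 addr0 !liftU.
by rewrite !scale1r fM addrAC addrK subrr scaler0.
Qed.

Lemma tlift_linear : linear (tlift f).
Proof.
by move=> a X Y; rewrite -[X]reprK -[Y]reprK -tpow_pi_linear !tlift_pi fglift_linear.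
Qed.

Lemma tlift_tens x : tlift f (tens x) = f x.
Proof. by rewrite tlift_pi liftU scale1r. Qed.

Lemma tlift_unique (g : tpow -> W) :
  linear g -> (forall x, g (tens x) = f x) -> g =1 tlift f.
Proof.
move=> gL gf X; have [s ->] := tens_span X.
have z h : linear h -> h 0 = 0 :> W.
  by move=> hL; have := hL 1 0 0; rewrite !scale1r addr0 => /(congr1 (+%R (- h 0)));
     rewrite addrA addNr add0r.
elim: s => [|r s IH]; first by rewrite big_nil !z//; exact: tlift_linear.
by rewrite !big_cons gL tlift_linear IH gf tlift_tens.
Qed.

End Lift.
End Multilinear.

Definition tpow_perm (K : comNzRingType) (V : lmodType K) (k : nat) (s : 'S_k)
    : tpow V k -> tpow V k :=
  tlift (fun x : {ffun 'I_k -> V} => tens [ffun i => x (s i)]).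

Section TensorAlgebra.
Variables (K : comNzRingType) (V : lmodType K).

Definition tprod : Type := forall k, tpow V k.
HB.instance Definition _ := gen_eqMixin tprod.
HB.instance Definition _ := gen_choiceMixin tprod.

Definition tprod_zero : tprod := fun=> 0.
Definition tprod_opp (X : tprod) : tprod := fun k => - X k.
Definition tprod_add (X Y : tprod) : tprod := fun k => X k + Y k.
Definition tprod_scale (a : K) (X : tprod) : tprod := fun k => a *: X k.

Lemma tprod_addA : associative tprod_add.
Proof. by move=> X Y Z; apply: functional_extensionality_dep => k; exact: addrA. Qed.
Lemma tprod_addC : commutative tprod_add.
Proof. by move=> X Y; apply: functional_extensionality_dep => k; exact: addrC. Qed.
Lemma tprod_add0 : left_id tprod_zero tprod_add.
Proof. by move=> X; apply: functional_extensionality_dep => k; exact: add0r. Qed.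
Lemma tprod_addN : left_inverse tprod_zero tprod_opp tprod_add.
Proof. by move=> X; apply: functional_extensionality_dep => k; exact: addNr. Qed.
HB.instance Definition _ := GRing.isZmodule.Build tprod
  tprod_addA tprod_addC tprod_add0 tprod_addN.

Lemma tprod_scaleA a b X : tprod_scale a (tprod_scale b X) = tprod_scale (a * b) X.
Proof. by apply: functional_extensionality_dep => k; exact: scalerA. Qed.
Lemma tprod_scale1 : left_id 1 tprod_scale.
Proof. by move=> X; apply: functional_extensionality_dep => k; exact: scale1r. Qed.
Lemma tprod_scaleDr : right_distributive tprod_scale +%R.
Proof. by move=> a X Y; apply: functional_extensionality_dep => k; exact: scalerDr. Qed.
Lemma tprod_scaleDl X : {morph tprod_scale^~ X : a b / a + b}.
Proof. by move=> a b; apply: functional_extensionality_dep => k; exact: scalerDl. Qed.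
HB.instance Definition _ := GRing.Zmodule_isLmodule.Build K tprod
  tprod_scaleA tprod_scale1 tprod_scaleDr tprod_scaleDl.

Definition finite_degree : {pred tprod} :=
  [pred X : tprod | `[< exists N, forall k, (N <= k)%N -> X k = 0 >] ].

Lemma finite_degreeP X :
  reflect (exists N, forall k, (N <= k)%N -> X k = 0) (X \in finite_degree).
Proof. exact: asboolP. Qed.

Lemma finite_degree_submod : submod_closed finite_degree.
Proof.
split=> [|a X Y /finite_degreeP[M XM] /finite_degreeP[N YN]].
  by apply/finite_degreeP; exists 0%N.
apply/finite_degreeP; exists (maxn M N) => k; rewrite geq_max => /andP[Mk Nk].
by rewrite (_ : (a *: X + Y) k = a *: X k + Y k)// XM// YN// scaler0 addr0.
Qed.
HB.instance Definition _ :=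
  GRing.isSubmodClosed.Build K tprod finite_degree finite_degree_submod.

Record talg : Type := TAlg { talg_val : tprod; _ : talg_val \in finite_degree }.
HB.instance Definition _ := [isSub for talg_val].
HB.instance Definition _ := [Choice of talg by <:].
HB.instance Definition _ := [SubChoice_isSubLmodule of talg by <:].

Definition tcomp (X : talg) (k : nat) : tpow V k := talg_val X k.

Definition symmetric_tensor : {pred talg} :=
  [pred X : talg | `[< forall k (s : 'S_k), tpow_perm s (tcomp X k) = tcomp X k >] ].

Lemma symmetric_tensorP X :
  reflect (forall k (s : 'S_k), tpow_perm s (tcomp X k) = tcomp X k)
          (X \in symmetric_tensor).
Proof. exact: asboolP. Qed.

Lemma tpow_perm_multilinear k (s : 'S_k) :
  multilinear (fun x : {ffun 'I_k -> V} => tens [ffun i => x (s i)]).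
Proof.
move=> x i a u v.
have E w : [ffun j => fupd x i w (s j)] = fupd [ffun j => x (s j)] (s^-1%g i) w.
  by apply/ffunP => j; rewrite !ffunE (canF_eq (permK s)).
by rewrite !E tens_multilinear.
Qed.

Lemma tpow_perm_linear k (s : 'S_k) : linear (@tpow_perm K V k s).
Proof. exact/tlift_linear/tpow_perm_multilinear. Qed.

Lemma tpow_perm_tens k (s : 'S_k) (x : {ffun 'I_k -> V}) :
  tpow_perm s (tens x) = tens [ffun i => x (s i)].
Proof. by rewrite /tpow_perm tlift_tens//; exact: tpow_perm_multilinear. Qed.

Lemma symmetric_tensor_submod : submod_closed symmetric_tensor.
Proof.
have P0 k (s : 'S_k) : tpow_perm s (0 : tpow V k) = 0.
  by apply: (addIr (tpow_perm s 0)); rewrite add0r -{1}[tpow_perm s 0]scale1r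
     -tpow_perm_linear scale1r addr0.
split=> [|a X Y /symmetric_tensorP HX /symmetric_tensorP HY].
  by apply/symmetric_tensorP => k s; exact: P0.
apply/symmetric_tensorP => k s.
rewrite (_ : tcomp (a *: X + Y) k = a *: tcomp X k + tcomp Y k)//.
by rewrite tpow_perm_linear HX HY.
Qed.
HB.instance Definition _ :=
  GRing.isSubmodClosed.Build K talg symmetric_tensor symmetric_tensor_submod.

Record stalg : Type := STAlg { stalg_val :> talg; _ : stalg_val \in symmetric_tensor }.
HB.instance Definition _ := [isSub for stalg_val].
HB.instance Definition _ := [Choice of stalg by <:].
HB.instance Definition _ := [SubChoice_isSubLmodule of stalg by <:].

End TensorAlgebra.

Section Seminorms.
Variables (R : realType) (V : tvsType R[i]).

Definition cont_seminorm (p : V -> R) :=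
  [/\ forall u v, p (u + v) <= p u + p v,
      forall (a : R[i]) v, p (a *: v) = complex.Re `|a| * p v
    & continuous p].

(* Antilinearity in the first argument follows from the first two clauses;
   in R[i], [0 <= z] says that z is real and nonnegative. *)
Definition positive_hermitian_form (h : V -> V -> R[i]) :=
  [/\ forall u, scalar (h u),
      forall u v, h u v = (h v u)^*
    & forall v, 0 <= h v v].

Definition cont_hermitian_forms : set (V -> V -> R[i]) :=
  [set h | positive_hermitian_form h /\
           continuous (fun uv : V * V => h uv.1 uv.2 : R[i]^o)].

Definition form_seminorm (h : V -> V -> R[i]) (v : V) : R :=
  Num.sqrt (complex.Re (h v v)).

Definition hilbert_seminorms : set (V -> R) :=
  form_seminorm @` cont_hermitian_forms.

(* The canonical map from V / ker q to the completion B of V / ker p is a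
   nuclear operator [sum_n a_n (x) y_n]: a continuous functional on V / ker q is
   a linear functional a on V with |a| <= c q, the least such c being its norm. *)
Definition nuclear_canonical_map (q p : V -> R) :=
  exists (B : completeNormedModType R[i]) (j : V -> B),
  [/\ linear j,
      (forall v, `|j v| = (p v)%:C%C),
      dense (range j)
    & exists (a : nat -> V -> R[i]) (c : R^nat) (y : nat -> B),
      [/\ forall n, scalar (a n),
          forall n, 0 <= c n /\ forall v, complex.Re `|a n v| <= c n * q v,
          cvgn (series (fun n => c n * complex.Re `|y n|))
        & forall v, series (fun n => a n v *: y n) @ \oo --> j v] ].

Definition nuclear_space :=
  forall p : V -> R, cont_seminorm p ->
  exists q : V -> R,
    [/\ cont_seminorm q, forall v, p v <= q v & nuclear_canonical_map q p].

End Seminorms.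

Section TensorSeminorms.
Variables (R : realType) (V : lmodType R[i]).

(* The inner tlift extends linearly in Y, the outer one, between two
   conjugations, antilinearly in X; see tpow_form_tens. *)
Definition tpow_form (h : V -> V -> R[i]) (k : nat) (X Y : tpow V k) : R[i] :=
  (tlift (fun x : {ffun 'I_k -> V} =>
     (tlift (fun y : {ffun 'I_k -> V} =>
        k`!%:R * \prod_(m < k) h (x m) (y m) : R[i]^o) Y)^* : R[i]^o) X)^*.

(* This sum and the one in talg_proj_seminorm are finitely supported. *)
Definition talg_form (h : V -> V -> R[i]) (X Y : talg V) : R[i] :=
  \sum_(k \in [set: nat]) tpow_form h (tcomp X k) (tcomp Y k).

Definition talg_seminorm (h : V -> V -> R[i]) (X : talg V) : R :=
  Num.sqrt (complex.Re (talg_form h X X)).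

(* The identification of the 0-th tensor power with the scalars. *)
Definition tpow0_scalar : tpow V 0 -> R[i] :=
  tlift (fun _ : {ffun 'I_0 -> V} => 1 : R[i]^o).

Definition proj_seminorm (p : V -> R) (k : nat) (X : tpow V k) : R :=
  inf [set r | exists s : seq {ffun 'I_k -> V},
                 X = \sum_(x <- s) tens x /\
                 r = \sum_(x <- s) \prod_(m < k) p (x m)].

Definition talg_proj_seminorm (p : V -> R) (X : talg V) : R :=
  complex.Re `|tpow0_scalar (tcomp X 0)| +
  \sum_(k \in [set k | (0 < k)%N]) Num.sqrt k`!%:R * proj_seminorm p (tcomp X k).

End TensorSeminorms.

(* The open sets of the locally convex topology defined by a family F of
   seminorms on E. *)
Definition seminorm_topology (R : realType) (E : zmodType) (F : set (E -> R)) :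
    set (set E) :=
  [set U | forall x, U x -> exists (G : set (E -> R)) (e : R),
     [/\ finite_set G, G `<=` F, 0 < e
       & forall y, (forall p, G p -> p (y - x) < e) -> U y] ].

Section TensorForms.
Variables (R : realType) (V : lmodType R[i]) (h : V -> V -> R[i]).
Hypothesis hlin : forall u, scalar (h u).
Hypothesis hherm : forall u v, h u v = (h v u)^*.

Lemma prod_fupd k (g : 'I_k -> V -> R[i]) (x : {ffun 'I_k -> V}) i v :
  \prod_(m < k) g m (fupd x i v m) = g i v * \prod_(m < k | m != i) g m (x m).
Proof.
rewrite (bigD1 i)//= ffunE eqxx; congr (_ * _).
by apply: eq_bigr => m /negbTE mi; rewrite ffunE mi.
Qed.

Lemma tpow_form_multilinear_r k (x : {ffun 'I_k -> V}) :
  multilinear (fun y : {ffun 'I_k -> V} =>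
    k`!%:R * \prod_(m < k) h (x m) (y m) : R[i]^o).
Proof.
move=> y i a u v /=; rewrite !(prod_fupd (fun m => h (x m))) hlin.
by rewrite /GRing.scale/= mulrDl mulrDr; congr (_ + _); rewrite -mulrA mulrCA.
Qed.

Lemma tpow_form_multilinear_l k (Y : tpow V k) :
  multilinear (fun x : {ffun 'I_k -> V} =>
     (tlift (fun y : {ffun 'I_k -> V} =>
        k`!%:R * \prod_(m < k) h (x m) (y m) : R[i]^o) Y)^* : R[i]^o).
Proof.
have hal u v w a : h (a *: u + v) w = a^* * h u w + h v w.
  by rewrite hherm hlin rmorphD rmorphM (hherm u) (hherm v).
move=> x i a u v /=; rewrite /GRing.scale/=.
pose T w := tlift (fun y : {ffun 'I_k -> V} =>
  k`!%:R * \prod_(m < k) h (fupd x i w m) (y m) : R[i]^o).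
rewrite -!/(T _ _).
have -> : T (a *: u + v) Y = a^* * T u Y + T v Y.
  have [s ->] := tens_span Y.
  pose L w := tlift_linear (tpow_form_multilinear_r (fupd x i w)).
  have z w : T w 0 = 0.
    by have := L w (-1) 0 0; rewrite scaler0 addr0 /GRing.scale/= mulN1r addNr.
  elim: s => [|[c y] s IH]; first by rewrite !big_nil !z mulr0 addr0.
  rewrite !big_cons /T !L !tlift_tens; try exact: tpow_form_multilinear_r.
  rewrite -/(T (a *: u + v) _) -/(T u _) -/(T v _) IH.
  have P w : \prod_(m < k) h (fupd x i w m) (y m) =
             h w (y i) * \prod_(m < k | m != i) h (x m) (y m).
    by rewrite (prod_fupd (fun m v => h v (y m))).
  by rewrite !P hal /GRing.scale/=; ring.
by rewrite rmorphD rmorphM /= conjCK.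
Qed.

Lemma tpow_form_tens k (x y : {ffun 'I_k -> V}) :
  tpow_form h (tens x) (tens y) = k`!%:R * \prod_(m < k) h (x m) (y m).
Proof.
rewrite /tpow_form tlift_tens; last exact: tpow_form_multilinear_l.
by rewrite conjCK tlift_tens//; exact: tpow_form_multilinear_r.
Qed.

Lemma tpow_form_linear_r k (X : tpow V k) : scalar (tpow_form h X).
Proof.
move=> a Y Z; have [s ->] := tens_span X.
pose L (W : tpow V k) := tlift_linear (tpow_form_multilinear_l W).
have z (W : tpow V k) : tlift (fun x : {ffun 'I_k -> V} =>
     (tlift (fun y : {ffun 'I_k -> V} =>
        k`!%:R * \prod_(m < k) h (x m) (y m) : R[i]^o) W)^* : R[i]^o) 0 = 0.
  by have := L W (-1) 0 0; rewrite scaler0 addr0 /GRing.scale/= mulN1r addNr.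
rewrite /tpow_form; elim: s => [|[c x] s IH].
  by rewrite !big_nil !z !conjC0 mulr0 addr0.
rewrite !big_cons !L !rmorphD /= IH !tlift_tens; try exact: tpow_form_multilinear_l.
rewrite (tlift_linear (tpow_form_multilinear_r x)) /GRing.scale/= !rmorphM /= !conjCK.
by ring.
Qed.

Lemma tpow_form_antilinear_l k (Y : tpow V k) a X Z :
  tpow_form h (a *: X + Z) Y = a^* * tpow_form h X Y + tpow_form h Z Y.
Proof.
by rewrite /tpow_form (tlift_linear (tpow_form_multilinear_l Y)) rmorphD rmorphM.
Qed.

End TensorForms.

(* Main.v *)
Require Import Defs.
From mathcomp Require Import all_boot all_order all_algebra complex ring lra.
From mathcomp Require Import all_classical all_reals all_analysis.
Set Implicit Arguments.
Unset Strict Implicit.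
Unset Printing Implicit Defensive.
Import Order.TTheory GRing.Theory Num.Theory numFieldNormedType.Exports.
Local Open Scope classical_set_scope.
Local Open Scope ring_scope.

(** The two families of seminorms dominate each other up to constants, which makes
    them define the same open sets.

    One direction holds for every positive Hermitian form [h]. If the degree [k]
    part of [X] is a sum of factorizing tensors, expanding the form at it and
    applying Cauchy-Schwarz to each pair of summands bounds its square root by
    [sqrt(k!)] times the sum of the products of the norms; taking the infimum and
    summing over [k] gives [talg_seminorm_le_proj].

    For the other direction let [p] be a Hilbertian seminorm. Suppose that [h] is a
    continuous form with [p <= ||.||_h] for which the identity of [V], from [h] to
    [p], is Hilbert-Schmidt with norm at most [T]. The finitely many vectors occurring
    in a tensor of degree [k] lie in the span of an [h]-orthogonal family [e]
    ([Gram_Schmidt], [tens_span_of_tens]), so [X = sum_g xi_g e_(g 1) (x) ... (x) e_(g k)]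
    over maps [g]. The form at [X] is [k! sum_g |xi_g|^2 prod_m h(e_(g m), e_(g m))],
    and the projective seminorm is at most [sum_g |xi_g| prod_m p(e_(g m))].
    Cauchy-Schwarz separates the two, leaving as a factor the square root of
    [sum_g prod_m p(e_(g m))^2 / h(e_(g m), e_(g m))], which is the [k]-th power of the
    Hilbert-Schmidt sum. Hence the part of degree [k] is estimated with factor
    [T^k] ([proj_le_tpow_seminorm]), and for [T = 1/2] the sum over [k] costs only a
    factor [2] ([talg_proj_le_seminorm]). Everything is a finite computation in [V],
    without completions.

    Nuclearity produces [h] ([nuclear_hilbert_schmidt]). If the canonical map from
    [q] to [p] is [sum_n a_n (x) y_n] with [|a_n| <= c_n q] and [b_n] the norm of
    [y_n], the form [g(u,v) = sum_n (b_n / c_n) conj(a_n u) a_n v] is continuous and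
    dominates [p^2] up to the factor [S = sum_n c_n b_n]. If moreover [q <= ||.||_h],
    Bessel's inequality for each [a_n] bounds the trace of [g] relative to [h] by
    [S]. A nuclear canonical map from some [q'] to [q] yields in the same way a form
    dominating [q] up to a factor; a large multiple of it is the required [h]. *)

(** * Modulus of a complex number *)

Section Modulus.
Variable R : realType.
Implicit Types (z w : R[i]) (r : R).

(** The modulus as an element of [R]: on [R[i]] the norm takes values in [R[i]],
    where the order is only partial. *)
Definition cabs z : R := complex.Re `|z|.

Lemma cabsE z : `|z| = (cabs z)%:C%C.
Proof. by rewrite /cabs normc_def. Qed.

Lemma cabs_ge0 z : 0 <= cabs z.
Proof. by rewrite -ler0c -cabsE. Qed.

Lemma cabsM z w : cabs (z * w) = cabs z * cabs w.
Proof. by apply: complexI; rewrite rmorphM /= -!cabsE normrM. Qed.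

Lemma cabsD z w : cabs (z + w) <= cabs z + cabs w.
Proof. by rewrite -lecR rmorphD /= -!cabsE ler_normD. Qed.

Lemma cabs_conj z : cabs z^* = cabs z.
Proof. by rewrite /cabs norm_conjC. Qed.

Lemma cabs_real r : 0 <= r -> cabs r%:C%C = r.
Proof. by move=> r0; apply: complexI; rewrite -cabsE ger0_norm// ler0c. Qed.

Lemma cabs0 : cabs 0 = 0. Proof. by rewrite /cabs normr0. Qed.
Lemma cabs1 : cabs 1 = 1. Proof. by rewrite /cabs normr1. Qed.

Lemma cabs_eq0 z : (cabs z == 0) = (z == 0).
Proof. by rewrite -[RHS]normr_eq0 cabsE -(inj_eq (@complexI R)). Qed.

Lemma cabs_prod (I : Type) (s : seq I) (F : I -> R[i]) :
  cabs (\prod_(i <- s) F i) = \prod_(i <- s) cabs (F i).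
Proof. exact: (big_morph cabs cabsM cabs1). Qed.

Lemma normr_Re_le_cabs z : `|complex.Re z| <= cabs z.
Proof.
rewrite /cabs normc_def /= -sqrtr_sqr ler_sqrt ?addr_ge0 ?sqr_ge0//.
by rewrite lerDl sqr_ge0.
Qed.

Lemma normr_Im_le_cabs z : `|complex.Im z| <= cabs z.
Proof.
rewrite /cabs normc_def /= -sqrtr_sqr ler_sqrt ?addr_ge0 ?sqr_ge0//.
by rewrite lerDr sqr_ge0.
Qed.

Lemma Re_le_cabs z : complex.Re z <= cabs z.
Proof. exact: le_trans (ler_norm _) (normr_Re_le_cabs z). Qed.

Lemma mul_conj_cabs z : z * z^* = (cabs z ^+ 2)%:C%C.
Proof. by rewrite -normCK cabsE rmorphXn. Qed.

Lemma ReD z w : complex.Re (z + w) = complex.Re z + complex.Re w.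
Proof. by case: z w => [? ?] [? ?]. Qed.

Lemma ReZ r z : complex.Re (r%:C%C * z) = r * complex.Re z.
Proof. by case: z => [a b] /=; rewrite mul0r subr0. Qed.

Lemma Re_sum (I : Type) (s : seq I) (P : pred I) (F : I -> R[i]) :
  complex.Re (\sum_(i <- s | P i) F i) = \sum_(i <- s | P i) complex.Re (F i).
Proof. exact: (big_morph _ ReD erefl). Qed.

Lemma Re_ge0 z : 0 <= z -> z = (complex.Re z)%:C%C.
Proof. by move=> /ger0_Im; case: z => a b /= ->. Qed.

End Modulus.

(** * Positive Hermitian forms *)

Section HermitianForm.
Variables (R : realType) (V : tvsType R[i]) (h : V -> V -> R[i]).
Hypothesis hP : positive_hermitian_form h.

Lemma form_linr u a v w : h u (a *: v + w) = a * h u v + h u w.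
Proof. by case: hP => hl _ _; rewrite hl. Qed.

Lemma form_herm u v : h u v = (h v u)^*.
Proof. by case: hP. Qed.

Lemma form_linl a u v w : h (a *: u + v) w = a^* * h u w + h v w.
Proof. by rewrite form_herm form_linr rmorphD rmorphM /= -!form_herm. Qed.

Lemma form0r u : h u 0 = 0.
Proof. by have := form_linr u (-1) 0 0; rewrite scaler0 addr0 mulN1r addNr. Qed.

Lemma form0l u : h 0 u = 0.
Proof. by rewrite form_herm form0r conjC0. Qed.

Lemma formZr u a v : h u (a *: v) = a * h u v.
Proof. by have := form_linr u a v 0; rewrite form0r !addr0. Qed.

Lemma formZl a u v : h (a *: u) v = a^* * h u v.
Proof. by rewrite form_herm formZr rmorphM /= -form_herm. Qed.

Lemma formDr u v w : h u (v + w) = h u v + h u w.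
Proof. by have := form_linr u 1 v w; rewrite scale1r mul1r. Qed.

Lemma formDl u v w : h (u + v) w = h u w + h v w.
Proof. by have := form_linl 1 u v w; rewrite scale1r conjC1 mul1r. Qed.

Lemma form_sumr (I : Type) (s : seq I) u (F : I -> V) :
  h u (\sum_(i <- s) F i) = \sum_(i <- s) h u (F i).
Proof. exact: (big_morph (h u) (formDr u) (form0r u)). Qed.

Lemma form_suml (I : Type) (s : seq I) u (F : I -> V) :
  h (\sum_(i <- s) F i) u = \sum_(i <- s) h (F i) u.
Proof. exact: (big_morph (h^~ u) (fun v w => formDl v w u) (form0l u)). Qed.

Let N v := complex.Re (h v v).

Lemma form_diag v : h v v = (N v)%:C%C.
Proof. by case: hP => _ _ h0; apply: Re_ge0. Qed.

Lemma form_diag_ge0 v : 0 <= N v.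
Proof. by case: hP => _ _ h0; rewrite -ler0c -form_diag. Qed.

Lemma form_seminorm_ge0 v : 0 <= form_seminorm h v.
Proof. exact: sqrtr_ge0. Qed.

Lemma form_seminorm_sqr v : form_seminorm h v ^+ 2 = N v.
Proof. by rewrite sqr_sqrtr// form_diag_ge0. Qed.

Lemma form_diag_lin (t : R[i]) u v :
  N (t *: v + u) =
    cabs t ^+ 2 * N v + 2 * complex.Re (t * h u v) + N u.
Proof.
rewrite /N form_linl !form_linr mulrDr !ReD.
have -> : complex.Re (t^* * (t * h v v)) = cabs t ^+ 2 * N v.
  by rewrite mulrA (mulrC _ t) mul_conj_cabs ReZ.
have -> : complex.Re (t^* * h v u) = complex.Re (t * h u v).
  by rewrite (form_herm v u) -rmorphM; case: (t * h u v).
by rewrite /N; ring.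
Qed.

(** Positivity of the form on [u - (h(v,u)/h(v,v)) v]; when [h(v,v) = 0] the
    form is affine in [t] at [u + t v], and positivity forces the slope to vanish. *)
Lemma form_CauchySchwarz_sqr u v : cabs (h u v) ^+ 2 <= N u * N v.
Proof.
pose z := h u v.
have key (s : R) : 0 <= s ^+ 2 * cabs z ^+ 2 * N v - 2 * s * cabs z ^+ 2 + N u.
  have := form_diag_ge0 ((- s)%:C%C * z^* *: v + u).
  rewrite form_diag_lin cabsM cabs_conj -/z exprMn -(mulrA _ z^*) (mulrC z^*).
  rewrite mul_conj_cabs.
  have -> : cabs (- s)%:C%C ^+ 2 = s ^+ 2.
    by rewrite /cabs normc_def /= expr0n addr0 sqr_sqrtr ?sqr_ge0// sqrrN.
  rewrite ReZ /= => H; apply: (le_trans H); lra.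
have := form_diag_ge0 v; rewrite le_eqVlt => /predU1P[v0|v0]; last first.
  have := key (N v)^-1; rewrite -/z => H.
  rewrite -ler_pdivrMr//; rewrite -subr_ge0; apply: (le_trans H).
  by rewrite le_eqVlt; apply/predU1P; left; field; rewrite gt_eqF.
rewrite -v0 mulr0 leNgt; apply/negP => z0.
(* With this parameter the affine function takes the value [- N u - 2]. *)
have := key ((N u + 1) / cabs z ^+ 2); rewrite -v0 mulr0 add0r leNgt => /negP; apply.
rewrite -mulrA divfK ?gt_eqF//; have := form_diag_ge0 u; lra.
Qed.

Lemma form_CauchySchwarz u v :
  cabs (h u v) <= form_seminorm h u * form_seminorm h v.
Proof.
rewrite -(@ler_pXn2r _ 2)// ?nnegrE ?cabs_ge0 ?mulr_ge0 ?sqrtr_ge0//.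
by rewrite exprMn !form_seminorm_sqr form_CauchySchwarz_sqr.
Qed.

Lemma form_seminormD u v :
  form_seminorm h (u + v) <= form_seminorm h u + form_seminorm h v.
Proof.
rewrite -(@ler_pXn2r _ 2)// ?nnegrE ?addr_ge0 ?sqrtr_ge0//.
rewrite form_seminorm_sqr sqrrD !form_seminorm_sqr -[u + v]addrC -[v in v + u]scale1r.
rewrite form_diag_lin cabs1 mul1r.
have := le_trans (Re_le_cabs _) (form_CauchySchwarz u v); lra.
Qed.

Lemma form_seminormZ a v : form_seminorm h (a *: v) = cabs a * form_seminorm h v.
Proof.
rewrite /form_seminorm formZl formZr mulrA (mulrC _ a) mul_conj_cabs ReZ.
by rewrite sqrtrM ?sqr_ge0// sqrtr_sqr ger0_norm// cabs_ge0.
Qed.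

End HermitianForm.

(** * Scalar functions *)

Section Scalar.
Variables (R : realType) (V : lmodType R[i]) (f : V -> R[i]).
Hypothesis fL : scalar f.

Lemma scalar_fun0 : f 0 = 0.
Proof. by have := fL (-1) 0 0; rewrite scaler0 addr0 mulN1r addNr. Qed.

Lemma scalar_funZ a v : f (a *: v) = a * f v.
Proof. by have := fL a v 0; rewrite scalar_fun0 !addr0. Qed.

Lemma scalar_funD v w : f (v + w) = f v + f w.
Proof. by have := fL 1 v w; rewrite scale1r mul1r. Qed.

Lemma scalar_fun_sum (I : Type) (s : seq I) (F : I -> V) :
  f (\sum_(i <- s) F i) = \sum_(i <- s) f (F i).
Proof. exact: (big_morph f scalar_funD scalar_fun0). Qed.

End Scalar.

(** * Orthogonal families: Bessel and Gram-Schmidt *)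

Section Orthogonal.
Variables (R : realType) (V : tvsType R[i]) (h : V -> V -> R[i]).
Hypothesis hP : positive_hermitian_form h.

Definition orthogonal_vectors n (e : 'I_n -> V) :=
  forall i j, i != j -> h (e i) (e j) = 0.

Let N v := complex.Re (h v v).

Lemma form_orthogonal_comb n (e : 'I_n -> V) (c : 'I_n -> R[i]) i :
  orthogonal_vectors e -> h (e i) (\sum_j c j *: e j) = c i * (N (e i))%:C%C.
Proof.
move=> eo; rewrite (form_sumr hP) (bigD1 i)//= formZr// -form_diag// big1 ?addr0//.
by move=> j ji; rewrite formZr// eo ?mulr0// eq_sym.
Qed.

Lemma form_orthogonal_sqr n (e : 'I_n -> V) (c : 'I_n -> R[i]) :
  orthogonal_vectors e ->
  N (\sum_j c j *: e j) = \sum_j cabs (c j) ^+ 2 * N (e j).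
Proof.
move=> eo; rewrite /N (form_suml hP) Re_sum; apply: eq_bigr => i _.
rewrite formZl// form_orthogonal_comb// mulrA (mulrC _ (c i)) mul_conj_cabs.
by rewrite ReZ.
Qed.

(** Testing the bound on [v = sum_i conj(f e_i) / h(e_i, e_i) e_i] gives
    [B <= c sqrt B] for the left-hand side [B]. *)
Lemma Bessel n (e : 'I_n -> V) (f : V -> R[i]) (c : R) :
  orthogonal_vectors e -> scalar f -> 0 <= c ->
  (forall v, cabs (f v) <= c * form_seminorm h v) ->
  \sum_i cabs (f (e i)) ^+ 2 / N (e i) <= c ^+ 2.
Proof.
move=> eo fL c0 fc; set B := \sum_i _.
have N0 v : 0 <= N v by exact: form_diag_ge0.
have B0 : 0 <= B by apply: sumr_ge0 => i _; rewrite divr_ge0 ?sqr_ge0.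
pose v := \sum_i ((f (e i))^* * ((N (e i))^-1)%:C%C) *: e i.
have fv : f v = B%:C%C.
  rewrite /v scalar_fun_sum// rmorph_sum; apply: eq_bigr => i _ /=.
  by rewrite scalar_funZ// mulrAC (mulrC _ (f _)) mul_conj_cabs [RHS]rmorphM.
have hv : form_seminorm h v = Num.sqrt B.
  congr Num.sqrt; rewrite -/(N v) form_orthogonal_sqr//; apply: eq_bigr => i _.
  rewrite cabsM cabs_conj cabs_real ?invr_ge0// exprMn -mulrA; congr (_ * _).
  have [->|/eqP n0] := N (e i) =P 0; first by rewrite invr0 mulr0.
  by rewrite expr2 mulfVK.
have := fc v; rewrite fv hv cabs_real// => H.
have [->|/eqP Bn0] := B =P 0; first by rewrite sqr_ge0.
have sB : 0 < Num.sqrt B by rewrite sqrtr_gt0 lt_neqAle eq_sym Bn0.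
rewrite -(sqr_sqrtr B0) ler_pXn2r ?nnegrE ?sqrtr_ge0//.
by rewrite -(ler_pM2r sB) -expr2 sqr_sqrtr.
Qed.

(** In the Gram-Schmidt step the projection coefficient onto [e_i] has
    denominator [h(e_i, e_i)]; when that vanishes, so does the numerator by
    Cauchy-Schwarz, and the vectors may be left unnormalised. *)
Lemma Gram_Schmidt (s : seq V) :
  exists n (e : 'I_n -> V), orthogonal_vectors e /\
    forall v, v \in s -> exists c : 'I_n -> R[i], v = \sum_i c i *: e i.
Proof.
elim: s => [|v s [n [e [eo es]]]].
  by exists 0%N, (fun=> 0); split=> [[]|v]; last rewrite in_nil.
pose d i := h (e i) v / h (e i) (e i).
pose w := v - \sum_i d i *: e i.
have ew i : h (e i) w = 0.
  rewrite /w -scaleN1r addrC form_linr// form_orthogonal_comb// -form_diag//.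
  have [h0|/eqP h0] := h (e i) (e i) =P 0; last first.
    by rewrite /d divfK// mulN1r addNr.
  have : cabs (h (e i) v) ^+ 2 <= 0.
    by have := form_CauchySchwarz_sqr hP (e i) v; rewrite h0 mul0r.
  rewrite h0 mulr0 mulr0 add0r => H; apply/eqP; rewrite -cabs_eq0.
  by rewrite -sqrf_eq0 eq_le H sqr_ge0.
have we i : h w (e i) = 0 by rewrite form_herm// ew conjC0.
pose e' (i : 'I_n.+1) := oapp e w (unlift ord0 i).
have e'0 : e' ord0 = w by rewrite /e' unlift_none.
have e'S i : e' (lift ord0 i) = e i by rewrite /e' liftK.
exists n.+1, e'; split.
  move=> i j; case: (unliftP ord0 i) => [i'|] ->; case: (unliftP ord0 j) => [j'|] ->.
  - by rewrite !e'S (inj_eq (@lift_inj _ _)) => /eo.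
  - by rewrite e'S e'0 ew.
  - by rewrite e'S e'0 we.
  - by rewrite eqxx.
have ext (a : R[i]) c : exists c' : 'I_n.+1 -> R[i],
    a *: w + \sum_i c i *: e i = \sum_i c' i *: e' i.
  exists (fun i => oapp c a (unlift ord0 i)).
  rewrite big_ord_recl e'0 unlift_none /=; congr (_ + _).
  by apply: eq_bigr => i _; rewrite e'S liftK.
move=> u; rewrite inE => /predU1P[->|/es[c ->]].
  by have [c' E] := ext 1 d; exists c'; rewrite -E scale1r subrK.
by have [c' E] := ext 0 c; exists c'; rewrite -E scale0r add0r.
Qed.

End Orthogonal.

(** * Cauchy-Schwarz for finite sums *)

Section FiniteCauchySchwarz.
Variable R : realType.

Lemma sum_CauchySchwarz (I : Type) (s : seq I) (a b : I -> R) :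
  (\sum_(i <- s) a i * b i) ^+ 2 <=
    (\sum_(i <- s) a i ^+ 2) * (\sum_(i <- s) b i ^+ 2).
Proof.
elim: s => [|i s]; first by rewrite !big_nil expr0n mul0r.
rewrite !big_cons.
have : 0 <= \sum_(j <- s) a j ^+ 2 by apply: sumr_ge0 => j _; exact: sqr_ge0.
have : 0 <= \sum_(j <- s) b j ^+ 2 by apply: sumr_ge0 => j _; exact: sqr_ge0.
move: (\sum_(j <- s) _) (\sum_(j <- s) _) (\sum_(j <- s) _) => S A B B0 A0 IH.
suff : 2 * (S * (a i * b i)) <= A * b i ^+ 2 + B * a i ^+ 2 by lra.
have X0 : 0 <= A * b i ^+ 2 by rewrite mulr_ge0 ?sqr_ge0.
have Y0 : 0 <= B * a i ^+ 2 by rewrite mulr_ge0 ?sqr_ge0.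
have : (S * (a i * b i)) ^+ 2 <= (A * b i ^+ 2) * (B * a i ^+ 2).
  rewrite exprMn.
  have -> : A * b i ^+ 2 * (B * a i ^+ 2) = (A * B) * (a i * b i) ^+ 2 by ring.
  by rewrite ler_wpM2r ?sqr_ge0.
move: X0 Y0; move: (A * _) (B * _) (S * _) => X Y Z X0 Y0 Z2.
rewrite leNgt; apply/negP => H; have := sqr_ge0 (X - Y).
have : (X + Y) ^+ 2 < (2 * Z) ^+ 2 by rewrite ltr_pXn2r ?nnegrE//; lra.
lra.
Qed.

(** Apply the previous inequality to [x_i sqrt(D_i)] and [b_i / sqrt(D_i)]. Weights
    may vanish where the summand does, division by zero giving zero; this covers
    degenerate forms and vanishing coefficients without case distinctions. *)
Lemma sum_CauchySchwarz_weight (I : Type) (s : seq I) (x b D : I -> R) :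
  (forall i, 0 <= D i) -> (forall i, D i = 0 -> x i * b i = 0) ->
  (\sum_(i <- s) x i * b i) ^+ 2 <=
    (\sum_(i <- s) x i ^+ 2 * D i) * (\sum_(i <- s) b i ^+ 2 / D i).
Proof.
move=> D0 Dz.
have -> : \sum_(i <- s) x i * b i =
    \sum_(i <- s) (x i * Num.sqrt (D i)) * (b i / Num.sqrt (D i)).
  apply: eq_bigr => i _; have [d0|/eqP d0] := D i =P 0.
    by rewrite Dz// d0 sqrtr0 mulr0 mul0r.
  have s0 : Num.sqrt (D i) != 0 by rewrite gt_eqF// sqrtr_gt0 lt_neqAle eq_sym d0 D0.
  by rewrite mulrACA mulrA (mulrC _ (b i)) -mulrA mulfV// mulr1 mulrC.
apply: (le_trans (sum_CauchySchwarz _ _ _)); rewrite le_eqVlt; apply/predU1P; left.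
by congr (_ * _); apply: eq_bigr => i _; rewrite ?exprVn exprMn ?exprVn sqr_sqrtr.
Qed.

End FiniteCauchySchwarz.

(** * Tensors over a finite family of vectors *)

Section TensorSpan.
Variables (K : comNzRingType) (V : lmodType K) (k : nat).
Implicit Types x : {ffun 'I_k -> V}.

Lemma fupd_id x m : fupd x m (x m) = x.
Proof. by apply/ffunP => j; rewrite ffunE; case: eqP => [->|]. Qed.

Lemma tens_fupd0 x m : tens (fupd x m 0) = 0.
Proof.
have := tens_multilinear x m (-1) 0 0.
by rewrite scaler0 addr0 scaleN1r addNr.
Qed.

Lemma tens_fupdZ x m a v : tens (fupd x m (a *: v)) = a *: tens (fupd x m v).
Proof.
by have := tens_multilinear x m a v 0; rewrite tens_fupd0 !addr0.
Qed.

Definition tens_span_of n (e : 'I_n -> V) (X : tpow V k) :=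
  exists xi : {ffun 'I_k -> 'I_n} -> K,
    X = \sum_g xi g *: tens [ffun m => e (g m)].

Lemma tens_span_of0 n (e : 'I_n -> V) : tens_span_of e 0.
Proof. by exists (fun=> 0); rewrite big1// => g _; rewrite scale0r. Qed.

Lemma tens_span_of_lin n (e : 'I_n -> V) a X Y :
  tens_span_of e X -> tens_span_of e Y -> tens_span_of e (a *: X + Y).
Proof.
move=> [xi ->] [eta ->]; exists (fun g => a * xi g + eta g).
rewrite scaler_sumr -big_split; apply: eq_bigr => g _ /=.
by rewrite scalerDl scalerA.
Qed.

(** Multilinear expansion, one slot at a time: [l] lists the slots not yet
    holding one of the [e i]. *)
Lemma tens_span_of_tens n (e : 'I_n -> V) x :
  (forall m, exists c : 'I_n -> K, x m = \sum_i c i *: e i) ->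
  tens_span_of e (tens x).
Proof.
move=> xe; have {xe} : forall m, m \in enum 'I_k ->
    exists c : 'I_n -> K, x m = \sum_i c i *: e i by [].
have : forall m, m \notin enum 'I_k -> exists i, x m = e i.
  by move=> m; rewrite mem_enum.
elim: (enum 'I_k) x => [|m l IH] x xe xs.
  have [g xg] := choice (fun m => xe m isT); exists (fun g' => (g' == finfun g)%:R).
  rewrite (bigD1 (finfun g))//= eqxx scale1r big1 ?addr0 => [|g' /negbTE ->].
    by congr tens; apply/ffunP => m; rewrite !ffunE -xg.
  by rewrite scale0r.
have [c xm] := xs m (mem_head _ _).
rewrite -[x](fupd_id _ m) xm.
have step a i v : tens_span_of e (tens (fupd x m v)) ->
    tens_span_of e (tens (fupd x m (a *: e i + v))).
  rewrite tens_multilinear; apply: tens_span_of_lin; apply: IH => j.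
    move=> jl; rewrite ffunE; case: eqP => [_|/eqP jm]; first by exists i.
    by apply: xe; rewrite inE negb_or jm.
  move=> jl; rewrite ffunE; case: eqP => [_|_]; last by apply: xs; rewrite inE jl orbT.
  exists (fun i' => (i' == i)%:R); rewrite (bigD1 i)//= eqxx scale1r big1 ?addr0// => i'.
  by move=> /negbTE ->; rewrite scale0r.
elim/big_rec: _ => [|i v _]; last exact: step.
by rewrite tens_fupd0; exact: tens_span_of0.
Qed.

End TensorSpan.

Section TensorForm.
Variables (R : realType) (V : tvsType R[i]) (h : V -> V -> R[i]).
Hypothesis hP : positive_hermitian_form h.
Variable k : nat.

Let N v := complex.Re (h v v).
Let hl : forall u, scalar (h u). Proof. by case: hP. Qed.
Let hh : forall u v, h u v = (h v u)^*. Proof. by case: hP. Qed.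

(** A tensor involves finitely many vectors only, so Gram-Schmidt on these reduces
    every computation in [V] tensored [k] times to a finite orthogonal family. *)
Lemma tpow_orthogonal_span (X : tpow V k) :
  exists n (e : 'I_n -> V), orthogonal_vectors h e /\ tens_span_of e X.
Proof.
have [s ->] := tens_span X.
have [n [e [eo es]]] :=
  Gram_Schmidt hP (flatten [seq [seq (r.2 : {ffun 'I_k -> V}) m | m <- enum 'I_k] | r <- s]).
exists n, e; split=> //; elim: s es => [|r s IH] es.
  by rewrite big_nil; exact: tens_span_of0.
rewrite big_cons; apply: tens_span_of_lin; last first.
  by apply: IH => v vs; apply: es; rewrite /= mem_cat vs orbT.
apply: tens_span_of_tens => m; apply: es.
by rewrite /= mem_cat map_f// mem_enum.
Qed.

Lemma tpow_form_sum (I : Type) (s : seq I) (c : I -> R[i])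
    (x : I -> {ffun 'I_k -> V}) (X := \sum_(i <- s) c i *: tens (x i)) :
  tpow_form h X X = k`!%:R * \sum_(i <- s) \sum_(j <- s)
    (c i)^* * (c j * \prod_(m < k) h (x i m) (x j m)).
Proof.
have L := tpow_form_linear_r hl hh.
have A0 Y : tpow_form h (0 : tpow V k) Y = 0.
  have := tpow_form_antilinear_l hl hh Y (-1) 0 0.
  by rewrite scaler0 addr0 rmorphN1 mulN1r addNr.
have -> Y : tpow_form h X Y = \sum_(i <- s) (c i)^* * tpow_form h (tens (x i)) Y.
  rewrite /X; elim: s {X} => [|i s IH]; first by rewrite !big_nil A0.
  by rewrite !big_cons tpow_form_antilinear_l// IH.
rewrite mulr_sumr; apply: eq_bigr => i _.
rewrite (scalar_fun_sum (L _ _)) !mulr_sumr; apply: eq_bigr => j _.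
by rewrite (scalar_funZ (L _ _)) tpow_form_tens//; ring.
Qed.

Lemma tpow_form_orthogonal n (e : 'I_n -> V) (xi : {ffun 'I_k -> 'I_n} -> R[i])
    (X := \sum_g xi g *: tens [ffun m => e (g m)]) :
  orthogonal_vectors h e ->
  complex.Re (tpow_form h X X) =
    k`!%:R * \sum_g cabs (xi g) ^+ 2 * \prod_m N (e (g m)).
Proof.
move=> eo; rewrite tpow_form_sum -(rmorph_nat (real_complex R)) ReZ Re_sum.
congr (_ * _); apply: eq_bigr => g _.
rewrite (bigD1 g)//= [X in _ + X]big1 => [|g' g'g].
  rewrite addr0 mulrA (mulrC _ (xi g)) mul_conj_cabs ReZ; congr (_ * _).
  rewrite (eq_bigr (fun m => (N (e (g m)))%:C%C)) => [|m _].
    by rewrite -rmorph_prod.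
  by rewrite !ffunE form_diag.
have [m gm] : exists m, g m != g' m.
  apply/existsP; apply: contraR g'g; rewrite negb_exists => /forallP H.
  by apply/eqP/ffunP => m; have := H m; rewrite negbK => /eqP.
by rewrite (bigD1 m)//= !ffunE eo// mul0r !mulr0.
Qed.

(** The easy comparison: a decomposition [X = sum_i x_i1 (x) ... (x) x_ik] bounds
    the form by Cauchy-Schwarz applied to each pair of summands. *)
Lemma tpow_form_le_sum (s : seq {ffun 'I_k -> V}) (X := \sum_(x <- s) tens x) :
  complex.Re (tpow_form h X X) <=
    k`!%:R * (\sum_(x <- s) \prod_(m < k) form_seminorm h (x m)) ^+ 2.
Proof.
have -> : X = \sum_(x <- s) 1 *: tens x by apply: eq_bigr => x _; rewrite scale1r.
rewrite tpow_form_sum -(rmorph_nat (real_complex R)) ReZ Re_sum ler_wpM2l ?ler0n//.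
rewrite expr2 mulr_suml; apply: ler_sum => x _; rewrite Re_sum mulr_sumr.
apply: ler_sum => y _; apply: (le_trans (Re_le_cabs _)).
rewrite conjC1 !mul1r cabs_prod -big_split; apply: ler_prod => m _ /=.
by rewrite cabs_ge0 form_CauchySchwarz.
Qed.

End TensorForm.

(** * Projective seminorms and the comparison in each degree *)

Section ProjectiveSeminorm.
Variables (R : realType) (V : lmodType R[i]) (p : V -> R).
Hypothesis p_ge0 : forall v, 0 <= p v.
Hypothesis pZ : forall a v, p (a *: v) = cabs a * p v.
Variable k : nat.

Lemma proj_seminorm_set_ge0 (X : tpow V k) :
  lbound [set r | exists s : seq {ffun 'I_k -> V},
                 X = \sum_(x <- s) tens x /\
                 r = \sum_(x <- s) \prod_(m < k) p (x m)] 0.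
Proof.
by move=> _ [s [_ ->]]; apply: sumr_ge0 => x _; apply: prodr_ge0.
Qed.

Lemma proj_seminorm0 : proj_seminorm p (0 : tpow V k) = 0.
Proof.
apply/eqP; rewrite eq_le; apply/andP; split.
  apply: ge_inf; first by exists 0; exact: proj_seminorm_set_ge0.
  by exists [::]; rewrite !big_nil.
apply: lb_le_inf; last exact: proj_seminorm_set_ge0.
by exists 0; exists [::]; rewrite !big_nil.
Qed.

Hypothesis k_gt0 : (0 < k)%N.

(** In positive degree a scalar can be absorbed into the first tensor factor. *)
Lemma tens_absorb (I : Type) (s : seq I) (c : I -> R[i])
    (x : I -> {ffun 'I_k -> V}) :
  exists t : seq {ffun 'I_k -> V},
    \sum_(i <- s) c i *: tens (x i) = \sum_(y <- t) tens y /\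
    \sum_(y <- t) \prod_(m < k) p (y m) =
      \sum_(i <- s) cabs (c i) * \prod_(m < k) p (x i m).
Proof.
pose m0 := Ordinal k_gt0.
exists [seq fupd (x i) m0 (c i *: x i m0) | i <- s]; rewrite !big_map; split.
  by apply: eq_bigr => i _; rewrite tens_fupdZ fupd_id.
apply: eq_bigr => i _; rewrite (bigD1 m0)//= ffunE eqxx pZ -mulrA; congr (_ * _).
rewrite [RHS](bigD1 m0)//=; congr (_ * _).
by apply: eq_bigr => m /negbTE mm0; rewrite ffunE mm0.
Qed.

Lemma proj_seminorm_le (I : Type) (s : seq I) (c : I -> R[i])
    (x : I -> {ffun 'I_k -> V}) :
  proj_seminorm p (\sum_(i <- s) c i *: tens (x i)) <=
    \sum_(i <- s) cabs (c i) * \prod_(m < k) p (x i m).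
Proof.
have [t [-> <-]] := tens_absorb s c x.
by apply: ge_inf; [exists 0; exact: proj_seminorm_set_ge0|exists t].
Qed.

Lemma le_proj_seminorm (X : tpow V k) r :
  (forall s, X = \sum_(x <- s) tens x -> r <= \sum_(x <- s) \prod_(m < k) p (x m)) ->
  r <= proj_seminorm p X.
Proof.
move=> H; apply: lb_le_inf; last by move=> _ [s [Xs ->]]; exact: H.
have [s ->] := tens_span X.
have [t [-> _]] := tens_absorb s (fun r => r.1) (fun r => r.2).
by eexists; exists t.
Qed.

End ProjectiveSeminorm.

Section DegreewiseComparison.
Variables (R : realType) (V : tvsType R[i]).
Implicit Types (h : V -> V -> R[i]) (p : V -> R).

Definition tpow_seminorm h k (X : tpow V k) : R :=
  Num.sqrt (complex.Re (tpow_form h X X)).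

Lemma tpow_form_ge0 h k (X : tpow V k) :
  positive_hermitian_form h -> 0 <= complex.Re (tpow_form h X X).
Proof.
move=> hP; have [n [e [eo [xi ->]]]] := tpow_orthogonal_span hP X.
rewrite tpow_form_orthogonal// mulr_ge0 ?ler0n// sumr_ge0// => g _.
by rewrite mulr_ge0 ?sqr_ge0// prodr_ge0// => m _; exact: form_diag_ge0.
Qed.

Lemma tpow_seminorm_le_proj h k (X : tpow V k) :
  positive_hermitian_form h -> (0 < k)%N ->
  tpow_seminorm h X <= Num.sqrt k`!%:R * proj_seminorm (form_seminorm h) X.
Proof.
move=> hP k0; have f0 : 0 < Num.sqrt (k`!%:R : R) by rewrite sqrtr_gt0 ltr0n fact_gt0.
rewrite mulrC -ler_pdivrMr//.
apply: (le_proj_seminorm (form_seminormZ hP) k0) => s Xs.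
have S0 : 0 <= \sum_(x <- s) \prod_(m < k) form_seminorm h (x m).
  by apply: sumr_ge0 => x _; apply: prodr_ge0 => m _; exact: form_seminorm_ge0.
rewrite ler_pdivrMr// -(@ler_pXn2r _ 2)// ?nnegrE ?sqrtr_ge0 ?mulr_ge0 ?sqrtr_ge0//.
rewrite exprMn !sqr_sqrtr ?ler0n ?tpow_form_ge0// mulrC Xs.
exact: tpow_form_le_sum.
Qed.

(** [p] is dominated by [h] and the identity from [V] with [h] to [V] with [p]
    has Hilbert-Schmidt norm at most [T], computed on unnormalised orthogonal
    families. *)
Definition hilbert_schmidt_bound h p (T : R) :=
  (forall v, p v <= form_seminorm h v) /\
  forall n (e : 'I_n -> V), orthogonal_vectors h e ->
    \sum_i p (e i) ^+ 2 / complex.Re (h (e i) (e i)) <= T ^+ 2.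

(** Expand [X] in tensors of [h]-orthogonal vectors. Cauchy-Schwarz separates the
    coefficients, whose weighted square sum is the form at [X], from
    [sum_g prod_m p(e_(g m))^2 / h(e_(g m), e_(g m))], which is the [k]-th power of
    the Hilbert-Schmidt sum. *)
Lemma proj_le_tpow_seminorm h p T k (X : tpow V k) :
  positive_hermitian_form h ->
  (forall v, 0 <= p v) -> (forall a v, p (a *: v) = cabs a * p v) ->
  0 <= T -> hilbert_schmidt_bound h p T -> (0 < k)%N ->
  Num.sqrt k`!%:R * proj_seminorm p X <= T ^+ k * tpow_seminorm h X.
Proof.
move=> hP p0 pZ T0 [ph HS] k0.
have [n [e [eo [xi ->]]]] := tpow_orthogonal_span hP X.
pose N v := complex.Re (h v v).
have N0 v : 0 <= N v by exact: form_diag_ge0.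
have f0 : 0 <= Num.sqrt (k`!%:R : R) by exact: sqrtr_ge0.
have sum0 : 0 <= \sum_g cabs (xi g) * \prod_(m < k) p (e (g m)).
  by apply: sumr_ge0 => g _; rewrite mulr_ge0 ?cabs_ge0// prodr_ge0.
have := proj_seminorm_le p0 pZ k0 (index_enum _) xi (fun g => [ffun m => e (g m)]).
under [X in _ <= X -> _]eq_bigr => g _.
  under eq_bigr do rewrite ffunE.
  over.
move=> /(ler_wpM2l f0)/le_trans; apply.
rewrite -(@ler_pXn2r _ 2)// ?nnegrE ?mulr_ge0 ?exprn_ge0 ?sqrtr_ge0//.
rewrite !exprMn !sqr_sqrtr ?ler0n ?tpow_form_ge0// tpow_form_orthogonal//.
rewrite [leRHS]mulrCA ler_wpM2l ?ler0n//.
pose D (g : {ffun 'I_k -> 'I_n}) := \prod_(m < k) N (e (g m)).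
have Dz g : D g = 0 -> cabs (xi g) * \prod_(m < k) p (e (g m)) = 0.
  move=> /eqP/prodf_eq0[m _ /eqP em0]; rewrite (bigD1 m)//=.
  have -> : p (e (g m)) = 0; last by rewrite mul0r mulr0.
  apply/eqP; rewrite eq_le p0 andbT.
  by have := ph (e (g m)); rewrite /form_seminorm -/(N _) em0 sqrtr0.
have D0 g : 0 <= D g by apply: prodr_ge0.
apply: (le_trans (sum_CauchySchwarz_weight _ D0 Dz)); rewrite mulrC.
apply: ler_wpM2r; first by apply: sumr_ge0 => g _; rewrite mulr_ge0 ?sqr_ge0.
under eq_bigr do rewrite -prodrXl -prodf_div.
rewrite -(bigA_distr_bigA (fun _ i => p (e i) ^+ 2 / N (e i))) prodr_const card_ord.
rewrite -exprM mulnC exprM; apply: lerXn2r; rewrite ?nnegrE ?sqr_ge0//; last exact: HS.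
by apply: sumr_ge0 => i _; rewrite divr_ge0 ?sqr_ge0.
Qed.

Lemma tpow0_seminorm h (X : tpow V 0) :
  positive_hermitian_form h -> cabs (tpow0_scalar X) = tpow_seminorm h X.
Proof.
move=> hP; pose x0 : {ffun 'I_0 -> V} := [ffun=> 0].
have [c ->] : exists c, X = c *: tens x0.
  have [s ->] := tens_span X; exists (\sum_(r <- s) r.1); rewrite scaler_suml.
  by apply: eq_bigr => r _; congr (_ *: tens _); apply/ffunP => -[].
have M : multilinear (fun _ : {ffun 'I_0 -> V} => 1 : R[i]^o) by move=> x [].
rewrite /tpow0_scalar (scalar_funZ (tlift_linear M)) tlift_tens// mulr1.
rewrite /tpow_seminorm.
have -> : c *: tens x0 = \sum_(i <- [:: tt]) c *: tens x0 by rewrite big_seq1.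
rewrite tpow_form_sum// !big_seq1 big_ord0 mulr1 mul1r mulrC mul_conj_cabs /=.
by rewrite sqrtr_sqr ger0_norm// cabs_ge0.
Qed.

End DegreewiseComparison.

Section GradedComparison.
Variables (R : realType) (V : tvsType R[i]).
Implicit Types (h : V -> V -> R[i]) (p : V -> R) (X : talg V).

Definition proj_summand p X (k : nat) : R :=
  if k is 0%N then cabs (tpow0_scalar (tcomp X 0))
  else Num.sqrt k`!%:R * proj_seminorm p (tcomp X k).

Lemma talg_finite X : exists n, forall k, (n < k)%N -> tcomp X k = 0.
Proof. by have /finite_degreeP[n Xn] := valP X; exists n => k /ltnW /Xn. Qed.

Lemma talg_seminormE h X n : positive_hermitian_form h ->
  (forall k, (n < k)%N -> tcomp X k = 0) ->
  talg_seminorm h X = Num.sqrt (\sum_(k < n.+1) tpow_seminorm h (tcomp X k) ^+ 2).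
Proof.
move=> hP Xn; rewrite /talg_seminorm /talg_form.
have hl u : scalar (h u) by case: hP.
have hh u v : h u v = (h v u)^* by case: hP.
rewrite (fsbigE (index_iota 0 n.+1)) ?iota_uniq//; last first.
  move=> k _; rewrite mem_index_iota /= -leqNgt => /Xn ->.
  exact: scalar_fun0 (tpow_form_linear_r hl hh _).
under eq_bigl do rewrite in_setT.
rewrite big_mkord Re_sum; congr Num.sqrt; apply: eq_bigr => k _.
by rewrite sqr_sqrtr// tpow_form_ge0.
Qed.

Lemma talg_proj_seminormE p X n : (forall v, 0 <= p v) ->
  (forall k, (n < k)%N -> tcomp X k = 0) ->
  talg_proj_seminorm p X = \sum_(k < n.+1) proj_summand p X k.
Proof.
move=> p0 Xn; rewrite /talg_proj_seminorm big_ord_recl; congr (_ + _).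
rewrite (fsbigE (index_iota 1 n.+1)) ?iota_uniq//; first last.
- by move=> k k0; rewrite mem_index_iota k0 /= -leqNgt => /Xn ->; rewrite proj_seminorm0 ?mulr0.
- by move=> k /=; rewrite mem_index_iota => /andP[].
rewrite big_add1 /= big_mkord; apply: eq_big => [k|k _]; last by [].
by apply/asboolP.
Qed.

Lemma talg_seminorm_le_proj h X : positive_hermitian_form h ->
  talg_seminorm h X <= talg_proj_seminorm (form_seminorm h) X.
Proof.
move=> hP; have [n Xn] := talg_finite X.
rewrite (talg_seminormE hP Xn) (talg_proj_seminormE (@form_seminorm_ge0 _ _ _) Xn).
set b := proj_summand _ _.
have ab k : tpow_seminorm h (tcomp X k) <= b k.
  by case: k => [|k]; [rewrite -tpow0_seminorm|exact: tpow_seminorm_le_proj].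
have b0 k : 0 <= b k by apply: le_trans (ab k); exact: sqrtr_ge0.
elim: n.+1 => [|m IH]; first by rewrite !big_ord0 sqrtr0.
move: IH; rewrite !big_ord_recr /=; set A := \sum_(k < m) _; set B := \sum_(k < m) _.
have A0 : 0 <= A by apply: sumr_ge0 => i _; exact: sqr_ge0.
have B0 : 0 <= B by apply: sumr_ge0.
move=> /(lerXn2r 2); rewrite ?nnegrE sqrtr_ge0 sqr_sqrtr// => /(_ isT B0) AB.
rewrite -(@ler_pXn2r _ 2)// ?nnegrE ?sqrtr_ge0 ?addr_ge0//.
rewrite sqr_sqrtr ?addr_ge0 ?sqr_ge0// sqrrD.
have : tpow_seminorm h (tcomp X m) ^+ 2 <= b m ^+ 2.
  by rewrite ler_pXn2r ?nnegrE ?sqrtr_ge0.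
have : 0 <= B * b m by rewrite mulr_ge0.
lra.
Qed.

(** With Hilbert-Schmidt bound [1/2] the degree [k] parts are compared with
    factor [2^-k], which turns the sum over degrees into a geometric series. *)
Lemma talg_proj_le_seminorm h p X : positive_hermitian_form h ->
  (forall v, 0 <= p v) -> (forall a v, p (a *: v) = cabs a * p v) ->
  hilbert_schmidt_bound h p 2^-1 ->
  talg_proj_seminorm p X <= 2 * talg_seminorm h X.
Proof.
move=> hP p0 pZ HS; have [n Xn] := talg_finite X.
rewrite (talg_proj_seminormE p0 Xn) (talg_seminormE hP Xn).
set A := Num.sqrt _.
have A0 : 0 <= A by exact: sqrtr_ge0.
have aA (k : 'I_n.+1) : tpow_seminorm h (tcomp X k) <= A.
  rewrite -[leLHS]ger0_norm ?sqrtr_ge0// -sqrtr_sqr ler_sqrt; last first.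
    by apply: sumr_ge0 => i _; exact: sqr_ge0.
  rewrite (bigD1 k)//= lerDl; apply: sumr_ge0 => i _; exact: sqr_ge0.
have half0 : 0 <= 2^-1 :> R by rewrite invr_ge0.
apply: (@le_trans _ _ (\sum_(k < n.+1) 2^-1 ^+ k * A)).
  apply: ler_sum => k _; apply: (@le_trans _ _ (2^-1 ^+ k * tpow_seminorm h (tcomp X k))).
    case: k => -[|k] /= _; first by rewrite (tpow0_seminorm _ hP) expr0 mul1r.
    exact: proj_le_tpow_seminorm.
  by rewrite ler_wpM2l ?exprn_ge0.
rewrite -mulr_suml ler_wpM2r//.
have -> m : \sum_(k < m) 2^-1 ^+ k = 2 - 2 * 2^-1 ^+ m :> R.
  elim: m => [|m IH]; first by rewrite big_ord0 expr0; lra.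
  by rewrite big_ord_recr /= IH exprS; lra.
by rewrite gerBl mulr_ge0 ?exprn_ge0.
Qed.

End GradedComparison.

(** * Complex series and the form of a nuclear map *)

Section ComplexSeries.
Variable R : realType.
Implicit Types (z : nat -> R[i]) (l : R[i]).

(** Convergence of a complex series, expressed on real and imaginary parts so
    that completeness is only used in [R]. *)
Definition complex_sum z l :=
  series (fun n => complex.Re (z n)) @ \oo --> complex.Re l /\
  series (fun n => complex.Im (z n)) @ \oo --> complex.Im l.

Lemma complex_sum_lin z z' l l' (x : R[i]) :
  complex_sum z l -> complex_sum z' l' ->
  complex_sum (fun n => x * z n + z' n) (x * l + l').
Proof.
move=> [zr zi] [zr' zi']; case: x => a b; split.
  have -> : complex.Re ((a +i* b)%C * l + l') =
      a * complex.Re l - b * complex.Im l + complex.Re l'.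
    by case: l {zr zi} => ? ?; case: l' {zr' zi'}.
  have -> : series (fun n => complex.Re ((a +i* b)%C * z n + z' n)) =
      fun N => a * series (fun n => complex.Re (z n)) N
        - b * series (fun n => complex.Im (z n)) N
        + series (fun n => complex.Re (z' n)) N.
    apply/funext => N; rewrite /series /= !mulr_sumr -sumrB -big_split.
    by apply: eq_bigr => n _ /=; case: (z n) => ? ?; case: (z' n).
  by apply: cvgD => //; apply: cvgB; apply: cvgM => //; exact: cvg_cst.
have -> : complex.Im ((a +i* b)%C * l + l') =
    a * complex.Im l + b * complex.Re l + complex.Im l'.
  by case: l {zr zi} => ? ?; case: l' {zr' zi'} => ? ? /=; rewrite (mulrC b).
have -> : series (fun n => complex.Im ((a +i* b)%C * z n + z' n)) =
    fun N => a * series (fun n => complex.Im (z n)) N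
      + b * series (fun n => complex.Re (z n)) N
      + series (fun n => complex.Im (z' n)) N.
  apply/funext => N; rewrite /series /= !mulr_sumr -!big_split.
  by apply: eq_bigr => n _ /=; case: (z n) => ? ?; case: (z' n).
by apply: cvgD => //; apply: cvgD; apply: cvgM => //; exact: cvg_cst.
Qed.

Lemma complex_sum_conj z l :
  complex_sum z l -> complex_sum (fun n => (z n)^*) l^*.
Proof.
move=> [zr zi]; split.
  have -> : complex.Re l^* = complex.Re l by case: (l).
  apply: cvg_trans zr; apply: near_eq_cvg; near=> N.
  by apply: eq_bigr => n _; case: (z n).
have -> : complex.Im l^* = - complex.Im l by case: (l).
have -> : series (fun n => complex.Im (z n)^*) =
    - (series (fun n => complex.Im (z n)) : R ^nat).
  apply/funext => N; rewrite fctE /series /= -sumrN.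
  by apply: eq_bigr => n _; case: (z n).
exact: cvgN.
Unshelve. all: by end_near. Qed.

Lemma complex_sum_unique z l l' : complex_sum z l -> complex_sum z l' -> l = l'.
Proof.
move=> [zr zi] [zr' zi']; apply/eqP; rewrite eq_complex.
by apply/andP; split; apply/eqP; [exact: (cvg_unique _ zr zr')|exact: (cvg_unique _ zi zi')].
Qed.

Lemma complex_sum_ex z (u : R ^nat) :
  (forall n, cabs (z n) <= u n) -> cvgn (series u) -> exists l, complex_sum z l.
Proof.
move=> zu uc.
have ex (r : nat -> R) : (forall n, `|r n| <= u n) -> cvgn (series r).
  move=> ru; apply: normed_cvg; apply: (series_le_cvg _ _ ru uc) => n.
    exact: normr_ge0.
  exact: le_trans (normr_ge0 _) (ru n).
exists (limn (series (fun n => complex.Re (z n))) +i*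
        limn (series (fun n => complex.Im (z n))))%C.
by split; apply: ex => n; apply: le_trans (zu n); [exact: normr_Re_le_cabs|exact: normr_Im_le_cabs].
Qed.

Lemma nonneg_series_le (u : R ^nat) (l : R) N : (forall n, 0 <= u n) ->
  series u @ \oo --> l -> series u N <= l.
Proof.
move=> u0 ul; rewrite -(cvg_lim _ ul)//; apply: nondecreasing_cvgn_le.
  by apply/nondecreasing_series => n _ _.
by apply/cvg_ex; exists l.
Qed.

End ComplexSeries.

Section NuclearForm.
Variables (R : realType) (V : tvsType R[i]) (q : V -> R).
Variables (a : nat -> V -> R[i]) (c b : R ^nat).
Hypothesis aL : forall n, scalar (a n).
Hypothesis c_ge0 : forall n, 0 <= c n.
Hypothesis b_ge0 : forall n, 0 <= b n.
Hypothesis ac : forall n v, cabs (a n v) <= c n * q v.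
Hypothesis q_ge0 : forall v, 0 <= q v.
Hypothesis cb : cvgn (series (fun n => c n * b n)).

Let w n := b n / c n.
Let S := limn (series (fun n => c n * b n)).

Let w_ge0 n : 0 <= w n. Proof. exact: divr_ge0. Qed.

Let wcc n : w n * c n ^+ 2 = c n * b n.
Proof.
have [->|/eqP c0] := c n =P 0; first by rewrite expr0n mulr0 mul0r.
by rewrite /w expr2 mulrA divfK// mulrC.
Qed.

Let term u v n := (w n)%:C%C * ((a n u)^* * a n v).

(** The form [sum_n (b_n / c_n) conj(a_n u) a_n v]. With these weights its value
    at [(v, v)], times [sum_n c_n b_n], dominates [(sum_n |a_n v| b_n)^2]. *)
Lemma nuclear_form_ex : exists g : V -> V -> R[i],
  forall u v, complex_sum (term u v) (g u v).
Proof.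
have H (uv : V * V) : exists l, complex_sum (term uv.1 uv.2) l.
  case: uv => u v; apply: (@complex_sum_ex _ _ (fun n => c n * b n * (q u * q v))).
    move=> n; rewrite /term !cabsM cabs_conj cabs_real// -wcc -(mulrA (w n)) ler_wpM2l//.
    have -> : c n ^+ 2 * (q u * q v) = (c n * q u) * (c n * q v) by ring.
    by apply: ler_pM; rewrite ?cabs_ge0.
  have -> : series (fun n => c n * b n * (q u * q v)) =
      fun N => series (fun n => c n * b n) N * (q u * q v).
    by apply/funext => N; rewrite /series /= mulr_suml.
  by apply: is_cvgM => //; exact: is_cvg_cst.
have [f fP] := choice H.
by exists (fun u v => f (u, v)) => u v; exact: fP (u, v).
Qed.

Variable g : V -> V -> R[i].
Hypothesis gP : forall u v, complex_sum (term u v) (g u v).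

Let Q v := complex.Re (g v v).

Lemma nuclear_form_diag_cvg v :
  series (fun n => w n * cabs (a n v) ^+ 2) @ \oo --> Q v.
Proof.
have [gr _] := gP v v; apply: cvg_trans gr; apply: near_eq_cvg; near=> N.
by apply: eq_bigr => n _; rewrite /term mulrC mulrC (mulrC _^*) mul_conj_cabs ReZ.
Unshelve. all: by end_near. Qed.

Lemma nuclear_form_positive : positive_hermitian_form g.
Proof.
have gl u : scalar (g u).
  move=> x v v'; apply: complex_sum_unique (gP _ _) _.
  have := complex_sum_lin x (gP u v) (gP u v'); congr complex_sum.
  by apply/funext => n; rewrite /term aL; ring.
have gh u v : g u v = (g v u)^*.
  apply: complex_sum_unique (gP _ _) _.
  have := complex_sum_conj (gP v u); congr complex_sum.
  apply/funext => n; rewrite /term.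
  have : ((w n)%:C%C)^* = (w n)%:C%C by exact: conjc_real.
  by move: (w n)%:C%C => W WW; rewrite !rmorphM /= conjCK WW (mulrC (a n v)).
split=> // v.
have vr : complex.Im (g v v) = 0.
  by have := gh v v; case: (g v v) => x y [] /eqP; rewrite -subr_eq0 opprK -mulr2n mulrn_eq0 => /eqP.
have v0 : 0 <= Q v.
  have -> : 0 = series (fun n => w n * cabs (a n v) ^+ 2) 0%N.
    by rewrite /series /= big_geq.
  apply: nonneg_series_le (@nuclear_form_diag_cvg v) => n.
  by rewrite mulr_ge0 ?sqr_ge0.
by rewrite lecE /= vr eqxx.
Qed.

(** Cauchy-Schwarz with the weights [b_n / c_n]. *)
Lemma nuclear_form_partial v N :
  (\sum_(0 <= n < N) cabs (a n v) * b n) ^+ 2 <= S * Q v.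
Proof.
have wz n : w n = 0 -> cabs (a n v) * b n = 0.
  move=> /eqP; rewrite /w mulf_eq0 invr_eq0 => /orP[/eqP ->|/eqP c0].
    by rewrite mulr0.
  have : cabs (a n v) <= 0 by have := ac n v; rewrite c0 mul0r.
  by move=> an; rewrite (@le_anti _ _ (cabs (a n v)) 0) ?mul0r// an cabs_ge0.
apply: (le_trans (sum_CauchySchwarz_weight _ w_ge0 wz)); rewrite mulrC.
apply: ler_pM.
- by apply: sumr_ge0 => n _; rewrite divr_ge0 ?sqr_ge0.
- by apply: sumr_ge0 => n _; rewrite mulr_ge0 ?sqr_ge0 ?cabs_ge0.
- apply: (@le_trans _ _ (series (fun n => c n * b n) N)); last first.
    by apply: nonneg_series_le => // n; rewrite mulr_ge0.
  rewrite le_eqVlt; apply/predU1P; left; apply: eq_bigr => n _.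
  rewrite /w invf_div; have [->|/eqP b0] := b n =P 0.
    by rewrite expr0n !mul0r mulr0.
  by rewrite mulrA mulrAC expr2 mulfK// mulrC.
have := nonneg_series_le N _ (@nuclear_form_diag_cvg v).
under eq_bigr do rewrite mulrC.
by apply=> n; rewrite mulr_ge0 ?sqr_ge0 ?cabs_ge0.
Qed.

Lemma nuclear_form_le v : Q v <= S * q v ^+ 2.
Proof.
rewrite -(cvg_lim _ (@nuclear_form_diag_cvg v))//; apply: limr_le.
  by apply/cvg_ex; exists (Q v); exact: nuclear_form_diag_cvg.
near=> N; apply: (@le_trans _ _ (series (fun n => c n * b n) N * q v ^+ 2)).
  rewrite /series /= mulr_suml; apply: ler_sum => n _.
  rewrite -wcc -(mulrA (w n)) -exprMn ler_wpM2l// ler_pXn2r ?nnegrE ?cabs_ge0 ?mulr_ge0//.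
rewrite ler_wpM2r ?sqr_ge0//; apply: nonneg_series_le => // n.
by rewrite mulr_ge0.
Unshelve. all: by end_near. Qed.

(** Trace bound: Bessel's inequality applied to each functional [a_n]. *)
Lemma nuclear_form_trace (h : V -> V -> R[i]) m (e : 'I_m -> V) :
  positive_hermitian_form h -> (forall v, q v <= form_seminorm h v) ->
  orthogonal_vectors h e ->
  \sum_i Q (e i) / complex.Re (h (e i) (e i)) <= S.
Proof.
move=> hP qh eo; pose D i := complex.Re (h (e i) (e i)).
have L : (\sum_i series (fun n => w n * cabs (a n (e i)) ^+ 2) N / D i)
    @[N --> \oo] --> \sum_i Q (e i) / D i.
  apply: cvg_big; first exact: add_continuous.
  by move=> i _; apply: cvgM; [exact: nuclear_form_diag_cvg|exact: cvg_cst].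
rewrite -(cvg_lim _ L)//; apply: limr_le; first by apply/cvg_ex; eexists; exact: L.
near=> N; apply: (@le_trans _ _ (series (fun n => c n * b n) N)); last first.
  by apply: nonneg_series_le => // n; rewrite mulr_ge0.
under eq_bigr do rewrite mulr_suml.
rewrite exchange_big; apply: ler_sum => n _ /=.
under eq_bigr do rewrite -mulrA.
rewrite -mulr_sumr -wcc ler_wpM2l//; apply: Bessel => // v.
by apply: (le_trans (ac n v)); rewrite ler_wpM2l.
Unshelve. all: by end_near. Qed.

End NuclearForm.

(** * Continuous forms and nuclear maps *)

Section ContinuousForms.
Variables (R : realType) (V : tvsType R[i]).
Implicit Types (h g : V -> V -> R[i]) (p q : V -> R).

Lemma cont_seminorm_ge0 q v : cont_seminorm q -> 0 <= q v.
Proof.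
move=> [qD qZ _]; have q0 : q 0 = 0 by rewrite -(scale0r 0) qZ normr0 mul0r.
have := qD v (-1 *: v); rewrite scaleN1r subrr q0 -scaleN1r qZ normrN1 mul1r; lra.
Qed.

(** By Cauchy-Schwarz, [|g(u0,v0) - g(u,v)| <= |g(u - u0, v)| + |g(u0, v - v0)|] is
    at most [K^2 (q(u - u0) q(v) + q(u0) q(v - v0))], so continuity of the one-variable
    function [q] suffices. *)
Lemma dominated_form_continuous g q (K : R) :
  positive_hermitian_form g -> cont_seminorm q -> 0 <= K ->
  (forall v, form_seminorm g v <= K * q v) ->
  continuous (fun uv : V * V => g uv.1 uv.2 : R[i]^o).
Proof.
move=> gP qS K0 gq [u0 v0].
have q0 v : 0 <= q v by exact: cont_seminorm_ge0.
have [_ qZ qc] := qS.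
have gK u v : cabs (g u v) <= K ^+ 2 * (q u * q v).
  apply: (le_trans (form_CauchySchwarz gP u v)).
  have -> : K ^+ 2 * (q u * q v) = (K * q u) * (K * q v) by ring.
  by apply: ler_pM; rewrite ?form_seminorm_ge0.
pose F (uv : V * V) := K ^+ 2 * (q (uv.1 - u0) * q uv.2 + q u0 * q (uv.2 - v0)).
have Fg uv : cabs (g u0 v0 - g uv.1 uv.2) <= F uv.
  have -> : g u0 v0 - g uv.1 uv.2 =
      - (g (uv.1 - u0) uv.2 + g u0 (uv.2 - v0)).
    rewrite -(scaleN1r u0) -(scaleN1r v0) formDl// formDr// formZl// formZr//.
    by rewrite rmorphN1; ring.
  rewrite /cabs normrN -/(cabs _); apply: (le_trans (cabsD _ _)).
  by rewrite /F mulrDr lerD.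
have F0 : F (u0, v0) = 0.
  by rewrite /F /= !subrr -(scale0r 0) qZ normr0 mul0r mul0r mulr0 addr0 mulr0.
have Fc : F uv @[uv --> (u0, v0)] --> F (u0, v0).
  have sub (f : V * V -> V) x y : f uv @[uv --> (u0, v0)] --> x ->
      q (f uv - y) @[uv --> (u0, v0)] --> q (x - y).
    move=> fx; apply: (@cvg_comp _ _ _ (fun uv => f uv - y) q); last exact: qc.
    apply: (@cvg_comp2 _ _ _ _ _ _ (nbhs y) _ _ _ _ f (fun=> y) (fun a b => a - b) fx).
      exact: cvg_cst.
    exact: (@sub_continuous V (x, y)).
  have c1 : q (uv.1 - u0) @[uv --> (u0, v0)] --> q (u0 - u0).
    by apply: sub; exact: cvg_fst.
  have c2 : q (uv.2 - v0) @[uv --> (u0, v0)] --> q (v0 - v0).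
    by apply: sub; exact: cvg_snd.
  have c3 : q uv.2 @[uv --> (u0, v0)] --> q v0.
    by apply: (@cvg_comp _ _ _ (fun uv : V * V => uv.2) q); [exact: cvg_snd|exact: qc].
  apply: cvgM; first exact: cvg_cst.
  by apply: cvgD; [exact: (cvgM c1 c3)|apply: cvgM c2; exact: cvg_cst].
apply/cvgrPdist_lt => eps eps0.
have epsE := Re_ge0 (ltW eps0).
have e0 : 0 < complex.Re eps by rewrite -ltcR -epsE.
move/cvgrPdist_lt : Fc => /(_ _ e0); apply: filterS => uv.
rewrite F0 sub0r normrN => Fe.
rewrite epsE cabsE ltcR; apply: le_lt_trans Fe.
by apply: (le_trans (Fg uv)); exact: ler_norm.
Qed.

Lemma form_seminorm_cont h :
  cont_hermitian_forms h -> cont_seminorm (form_seminorm h).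
Proof.
move=> [hP hc]; split; [exact: form_seminormD|exact: form_seminormZ|] => v.
apply: (@cvg_comp _ _ _ (fun v => complex.Re (h v v)) Num.sqrt); last exact: sqrt_continuous.
have hv : (h u u : R[i]^o) @[u --> v] --> (h v v : R[i]^o).
  apply: (@cvg_comp _ _ _ (fun u : V => (u, u)) (fun uv => h uv.1 uv.2 : R[i]^o)).
    by apply: (@cvg_pair _ _ _ _ (nbhs v) (nbhs v)); exact: cvg_id.
  exact: hc (v, v).
apply/cvgrPdist_lt => e e0.
have e0' : 0 < e%:C%C by rewrite ltcR.
move/cvgrPdist_lt : hv => /(_ _ e0'); apply: filterS => u.
rewrite cabsE ltcR; apply: le_lt_trans.
by apply: le_trans (normr_Re_le_cabs _); case: (h v v) (h u u) => [? ?] [].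
Qed.

Lemma form_scale h (r : R) : 0 <= r -> cont_hermitian_forms h ->
  cont_hermitian_forms (fun u v => r%:C%C * h u v).
Proof.
move=> r0 [hP hc]; split; last first.
  by move=> uv; apply: cvgM; [exact: cvg_cst|exact: hc].
split=> [u a v w|u v|v].
- by rewrite form_linr//; ring.
- by rewrite rmorphM /= -form_herm//; congr (_ * _); rewrite -[RHS]/(conjc _) conjc_real.
- by rewrite mulr_ge0 ?ler0c//; case: hP.
Qed.

Lemma form_seminorm_scale h (r : R) v : 0 <= r ->
  form_seminorm (fun u v => r%:C%C * h u v) v = Num.sqrt r * form_seminorm h v.
Proof. by move=> r0; rewrite /form_seminorm ReZ sqrtrM. Qed.

(** What is used of a nuclear canonical map: with [b_n] the norm of [y_n], it gives
    [p v <= sum_n |a_n v| b_n], the value of the series being expressed by its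
    upper bounds. *)
Lemma nuclear_map_bound p q : nuclear_canonical_map q p ->
  exists (a : nat -> V -> R[i]) (c b : R ^nat),
  [/\ forall n, scalar (a n), forall n, 0 <= c n /\ 0 <= b n,
      forall n v, cabs (a n v) <= c n * q v,
      cvgn (series (fun n => c n * b n))
    & forall v M, (forall N, \sum_(0 <= n < N) cabs (a n v) * b n <= M) -> p v <= M].
Proof.
move=> [B [j [jL jp _ [a [c [y [aL ac cy jv]]]]]]].
exists a, c, (fun n => complex.Re `|y n|).
have yE n : `|y n| = (complex.Re `|y n|)%:C%C by exact: Re_ge0.
split=> // [n|n v|v M H].
- by split; [case: (ac n)|rewrite -ler0c -yE].
- by have [_ ] := ac n; apply.
rewrite leNgt; apply/negP => Mp.
have e0 : 0 < (p v - M)%:C%C by rewrite ltcR subr_gt0.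
have : \forall N \near \oo, False.
  have /cvgrPdist_lt/(_ _ e0) := @jv v; apply: filterS => N /=.
  move=> near_jv; have : (p v)%:C%C < (p v)%:C%C; last by rewrite ltxx.
  rewrite -[ltLHS]jp -(subrK (series (fun n => a n v *: y n) N) (j v)).
  apply: le_lt_trans (ler_normD _ _) _.
  rewrite -[in ltRHS](subrK M (p v)) rmorphD; apply: ltr_leD near_jv _.
  apply: (le_trans (ler_norm_sum _ _ _)); apply: (@le_trans _ _ (\sum_(0 <= n < N)
    cabs (a n v) * complex.Re `|y n|)%:C%C); last by rewrite lecR.
  rewrite rmorph_sum; apply: ler_sum => n _.
  by rewrite normrZ cabsE yE -rmorphM.
by case=> N _ /(_ N); apply => /=.
Qed.

End ContinuousForms.

(** * Hilbert-Schmidt bounds in a nuclear space *)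

Section NuclearSpace.
Variables (R : realType) (V : tvsType R[i]).

(** The representation of the canonical map splits it through a form [g]: [p] is
    continuous for [g], and [g] has trace at most [S] with respect to every form
    dominating [q]. *)
Lemma nuclear_trace_form (p q : V -> R) :
  cont_seminorm p -> cont_seminorm q -> nuclear_canonical_map q p ->
  exists (g : V -> V -> R[i]) (S : R), [/\ cont_hermitian_forms g, 0 <= S,
    forall v, p v ^+ 2 <= S * complex.Re (g v v)
  & forall h m (e : 'I_m -> V), positive_hermitian_form h ->
      (forall v, q v <= form_seminorm h v) -> orthogonal_vectors h e ->
      \sum_i complex.Re (g (e i) (e i)) / complex.Re (h (e i) (e i)) <= S].
Proof.
move=> pS qS /nuclear_map_bound[a [c [b [aL cb0 ac cbS pM]]]].
have c0 n : 0 <= c n by case: (cb0 n).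
have b0 n : 0 <= b n by case: (cb0 n).
have p0 v : 0 <= p v by exact: cont_seminorm_ge0.
have q0 v : 0 <= q v by exact: cont_seminorm_ge0.
have [g gE] := nuclear_form_ex c0 b0 ac cbS.
have gP := nuclear_form_positive aL c0 b0 gE.
pose S := limn (series (fun n => c n * b n)); exists g, S.
have S0 : 0 <= S.
  have -> : 0 = series (fun n => c n * b n) 0%N by rewrite /series /= big_geq.
  by apply: nonneg_series_le cbS => n; rewrite mulr_ge0.
split=> //.
- split=> //; apply: (dominated_form_continuous gP qS (sqrtr_ge0 S)) => v.
  rewrite -[q v]ger0_norm// -sqrtr_sqr -sqrtrM// ler_sqrt ?mulr_ge0 ?sqr_ge0//.
  exact: (nuclear_form_le c0 b0 ac q0 cbS gE).
- move=> v; have Q0 : 0 <= complex.Re (g v v) by exact: form_diag_ge0.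
  rewrite -[leRHS]sqr_sqrtr ?mulr_ge0// ler_pXn2r ?nnegrE ?sqrtr_ge0//.
  apply: pM => N; rewrite -[leLHS]ger0_norm; last first.
    by apply: sumr_ge0 => n _; rewrite mulr_ge0 ?cabs_ge0.
  rewrite -sqrtr_sqr ler_sqrt ?mulr_ge0//.
  exact: (nuclear_form_partial c0 b0 ac cbS gE).
- by move=> h m e hP qh eo; exact: (nuclear_form_trace aL c0 b0 ac cbS gE hP qh eo).
Qed.

(** Nuclearity is used twice: the map from [q] to [p] provides the trace, and the
    map from [q'] to [q] provides a Hermitian form dominating [q], with respect to
    which that trace is taken. Rescaling the form makes the bound small. *)
Lemma nuclear_hilbert_schmidt (h0 : V -> V -> R[i]) :
  nuclear_space V -> cont_hermitian_forms h0 ->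
  exists2 h : V -> V -> R[i], cont_hermitian_forms h &
    hilbert_schmidt_bound h (form_seminorm h0) 2^-1.
Proof.
move=> Vnuc h0c; pose p := form_seminorm h0.
have pS : cont_seminorm p by exact: form_seminorm_cont.
have [q [qS pq /(nuclear_trace_form pS qS)[g1 [S1 [g1c S10 pg1 g1tr]]]]] := Vnuc p pS.
have [q' [q'S _ /(nuclear_trace_form qS q'S)[g2 [S2 [g2c S20 qg2 _]]]]] := Vnuc q qS.
have p0 v : 0 <= p v by exact: form_seminorm_ge0.
have q0 v : 0 <= q v by exact: cont_seminorm_ge0.
pose h2 u v := S2%:C%C * g2 u v.
have h2c : cont_hermitian_forms h2 by exact: form_scale.
have qh2 v : q v <= form_seminorm h2 v.
  rewrite -[q v]ger0_norm// -sqrtr_sqr ler_sqrt; last exact: form_diag_ge0 h2c.1 v.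
  by rewrite /h2 ReZ.
(* The factor [k] divides the Hilbert-Schmidt sum, at most [S1^2], down to [1/4]. *)
pose k := 4 * S1 ^+ 2 + 1.
have k1 : 1 <= k by rewrite lerDr mulr_ge0 ?sqr_ge0.
have k0 : 0 < k by apply: lt_le_trans k1.
exists (fun u v => k%:C%C * h2 u v); first exact: form_scale (ltW k0) h2c.
split=> [v|n e eo].
  apply: (le_trans (pq v)); apply: (le_trans (qh2 v)).
  rewrite [leRHS](form_seminorm_scale _ _ (ltW k0)) ler_peMl ?sqrtr_ge0//.
  by rewrite -[leLHS]sqrtr1 ler_sqrt// ltW.
have eo2 : orthogonal_vectors h2 e.
  move=> i j /eo /eqP; rewrite mulf_eq0 => /orP[|/eqP//].
  by move=> /eqP/complexI k00; move: k0; rewrite k00 ltxx.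
pose D i := complex.Re (h2 (e i) (e i)).
have D0 i : 0 <= D i by exact: form_diag_ge0 h2c.1 _.
apply: (@le_trans _ _ (S1 / k * \sum_i complex.Re (g1 (e i) (e i)) / D i)).
  rewrite mulr_sumr; apply: ler_sum => i _; rewrite ReZ -/(D i) invfM.
  have -> : S1 / k * (complex.Re (g1 (e i) (e i)) / D i) =
      S1 * complex.Re (g1 (e i) (e i)) * (k^-1 * (D i)^-1) by ring.
  by apply: ler_wpM2r; rewrite ?mulr_ge0 ?invr_ge0// ltW.
apply: (@le_trans _ _ (S1 / k * S1)).
  apply: ler_wpM2l; first exact: divr_ge0 S10 (ltW k0).
  exact: g1tr h2c.1 qh2 eo2.
rewrite mulrAC ler_pdivrMr// /k -expr2 exprVn; lra.
Qed.

End NuclearSpace.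

(** * Topologies defined by seminorms *)

Lemma seminorm_topology_le (R : realType) (E : zmodType) (F F' : set (E -> R))
    (C : R) : 0 < C ->
  (forall p, F p -> exists2 p', F' p' & forall x, p x <= C * p' x) ->
  seminorm_topology F `<=` seminorm_topology F'.
Proof.
move=> C0 FF' U HU x /HU[G [eps [Gfin GF eps0 GU]]].
have H p : exists p', G p -> F' p' /\ forall x, p x <= C * p' x.
  have [Gp|nGp] := pselect (G p); last by exists p.
  by have [p' F'p' pp'] := FF' p (GF p Gp); exists p'.
have [f fP] := choice H.
exists (f @` G), (eps / C); split.
- exact: finite_image.
- by move=> _ [p Gp <-]; case: (fP p Gp).
- by rewrite divr_gt0.
move=> y Gy; apply: GU => p Gp; have [_ pf] := fP p Gp.
apply: (le_lt_trans (pf _)); rewrite mulrC -ltr_pdivlMr//.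
by apply: Gy; exists p.
Qed.

Theorem proposition4p4 (R : realType) (V : tvsType R[i])
    (V_hausdorff : hausdorff_space V) (V_nuclear : nuclear_space V) :
  seminorm_topology
    [set (fun X : stalg V => talg_seminorm h X) | h in @cont_hermitian_forms R V] =
  seminorm_topology
    [set (fun X : stalg V => talg_proj_seminorm p X) | p in @hilbert_seminorms R V].
Proof.
apply/seteqP; split.
  apply: (@seminorm_topology_le _ _ _ _ 1) => // _ [h hc <-].
  exists (fun X : stalg V => talg_proj_seminorm (form_seminorm h) X).
    by exists (form_seminorm h) => //; exists h.
  by move=> X; rewrite mul1r; exact: talg_seminorm_le_proj hc.1.
apply: (@seminorm_topology_le _ _ _ _ 2) => // _ [_ [h0 h0c <-] <-].
have [h hc HS] := nuclear_hilbert_schmidt V_nuclear h0c.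
exists (fun X : stalg V => talg_seminorm h X); first by exists h.
move=> X; apply: talg_proj_le_seminorm hc.1 _ _ HS.
  exact: form_seminorm_ge0.
exact: form_seminormZ h0c.1.
Qed.
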